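(* Assume $0<w_i<\infty$ for all $i\in S$. For each $\boldsymbol{\mu}\in\mathcal{M}(\mathbb{R}^d)^\ell$, define the law of $\boldsymbol{X}$ with initial configuration $\boldsymbol{\mu}$ conditioned on becoming extinct by $$\mathbb{P}^\dag_{\boldsymbol{\mu}}(A)=\mathbb{P}_{\boldsymbol{\mu}}(A\mid\mathcal{E})$$ for all events $A$ measurable with respect to $\mathcal{F}$. Then, for all $\boldsymbol{f}\in\mathcal{B}^+(\mathbb{R}^d)^\ell$ and $t\ge0$, $$\mathbb{E}^\dag_{\boldsymbol{\mu}}\left[e^{-\langle\boldsymbol{f},\boldsymbol{X}_t\rangle}\right]=\exp\big\{-\langle\boldsymbol{V}^\dag_t\boldsymbol{f},\boldsymbol{\mu}\rangle\big\},$$ where $$V^{\dag,(i)}_t\boldsymbol{f}(x):=V^{(i)}_t(\boldsymbol{f}+\boldsymbol{w})(x)-w_i,\qquad i\in S,$$ is the unique locally bounded solution of $$V^{\dag,(i)}_t\boldsymbol{f}(x)=\mathtt{P}^{(i)}_tf_i(x)-\int_0^tds\int_{\mathbb{R}^d}\psi^\dag(i,\boldsymbol{V}^\dag_{t-s}\boldsymbol{f}(y))\,\mathtt{P}^{(i)}_s(x,dy),\qquad i\in S,$$ with $\psi^\dag(i,\boldsymbol{\lambda}):=\psi(i,\boldsymbol{\lambda}+\boldsymbol{w})$. In other words, $(\boldsymbol{X},\mathbb{P}^\dag_{\boldsymbol{\mu}})$ is a $(\boldsymbol{\mathtt{P}},\boldsymbol{\psi}^\dag)$-multitype superprocess.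
   Context: $\ell\in\mathbb{N}$, $S=\{1,\dots,\ell\}$. $\mathcal{M}(\mathbb{R}^d)$ is the space of finite Borel measures on $\mathbb{R}^d$ with the weak topology; $\mathcal{B}^+(\mathbb{R}^d)$ the positive (nonnegative) bounded Borel functions. $[\boldsymbol{u},\boldsymbol{v}]=\sum_ju_jv_j$; $\langle\boldsymbol{f},\boldsymbol{\mu}\rangle=\sum_i\int f_i\,d\mu_i$; $\|\boldsymbol{\mu}\|=\langle\boldsymbol{1},\boldsymbol{\mu}\rangle$; $\boldsymbol{e}_1,\dots,\boldsymbol{e}_\ell$ is the natural basis of $\mathbb{R}^\ell$; $\boldsymbol{e}_i\delta_x$ is the vector of measures with $\delta_x$ in coordinate $i$ and zero elsewhere. ''Locally bounded'' means bounded on $[0,T]\times\mathbb{R}^d$ for each $T>0$. For $i\in S$, $(\mathtt{P}^{(i)}_t)_{t\ge0}$ is the transition semigroup of a conservative diffusion on $\mathbb{R}^d$. A branching mechanism is a function of the form $$\psi(i,\boldsymbol{\theta})=-[\boldsymbol{\theta},\boldsymbol{B}\boldsymbol{e}_i]+\beta_i\theta_i^2+\int_{\mathbb{R}^\ell_+}\left(e^{-[\boldsymbol{\theta},\boldsymbol{y}]}-1+\theta_iy_i\right)\Pi(i,d\boldsymbol{y}),\quad\boldsymbol{\theta}\in\mathbb{R}_+^\ell,\ i\in S,$$ with $\boldsymbol{B}$ a real $\ell\times\ell$ matrix with nonnegative off-diagonal entries, $\beta_i\ge0$, and $\Pi(i,\cdot)$ measures on $\mathbb{R}_+^\ell\setminus\{\boldsymbol{0}\}$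 with $\int\big((|\boldsymbol{y}|\wedge|\boldsymbol{y}|^2)+\sum_{j\ne i}y_j\big)\Pi(i,d\boldsymbol{y})<\infty$. The $(\boldsymbol{\mathtt{P}},\boldsymbol{\psi})$-multitype superprocess $(\boldsymbol{X},\mathbb{P}_{\boldsymbol{\mu}})$ is the strong Markov process on $\mathcal{M}(\mathbb{R}^d)^\ell$ with $\mathbb{E}_{\boldsymbol{\mu}}[e^{-\langle\boldsymbol{f},\boldsymbol{X}_t\rangle}]=e^{-\langle\boldsymbol{V}_t\boldsymbol{f},\boldsymbol{\mu}\rangle}$ for $\boldsymbol{f}\in\mathcal{B}^+(\mathbb{R}^d)^\ell$, where $\boldsymbol{V}_t\boldsymbol{f}=(V_t^{(1)}\boldsymbol f,\dots,V_t^{(\ell)}\boldsymbol f)^t\ge0$ is the unique locally bounded solution of $V^{(i)}_t\boldsymbol{f}(x)=\mathtt{P}^{(i)}_tf_i(x)-\int_0^tds\int_{\mathbb{R}^d}\psi(i,\boldsymbol{V}_{t-s}\boldsymbol{f}(y))\mathtt{P}^{(i)}_s(x,dy)$, $i\in S$. $\mathcal{F}_t=\sigma(\boldsymbol{X}_s,s\le t)$ and $\mathcal{F}=\sigma(\boldsymbol{X}_s,s\ge0)$. Standing assumption: the transpose of the matrix $\widetilde{B}_{i,j}=B_{i,j}+\int(y_i-\delta_{i,j})^+\Pi(j,d\boldsymbol{y})$ is irreducible. $\mathcal{E}=\{\|\boldsymbol{X}_t\|=0\text{ for some }t>0\}$ is the event of extinction, and $w_i=-\log\mathbb{P}_{\boldsymbol{e}_i\delta_x}(\mathcal{E})$,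 which does not depend on $x\in\mathbb{R}^d$; $\boldsymbol{w}=(w_1,\dots,w_\ell)$. *)

(* Defs.v *)
From HB Require Import structures.
From mathcomp Require Import all_boot all_order all_algebra perm.
From mathcomp Require Import all_classical all_reals all_analysis.
From mathcomp Require Import measurable_realfun.

Set Implicit Arguments.
Unset Strict Implicit.
Unset Printing Implicit Defensive.

Import Order.TTheory GRing.Theory Num.Theory.
Import numFieldNormedType.Exports.

Local Open Scope classical_set_scope.
Local Open Scope ring_scope.

Definition borelType (E : ptopologicalType) : Type :=
  g_sigma_algebraType (@open E).

HB.instance Definition _ (E : ptopologicalType) :=
  PointedTopological.copy (borelType E) E.
HB.instance Definition _ (E : ptopologicalType) :=
  Measurable.copy (borelType E) (g_sigma_algebraType (@open E)).

Definition euclidean (R : realType) (n : nat) := borelType 'cV[R]_n.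

Section measure_spaces.
Variables (R : realType) (d : nat).

Definition finite_measures : Type :=
  {finite_measure set (euclidean R d) -> \bar R}.

HB.instance Definition _ := gen_eqMixin finite_measures.
HB.instance Definition _ := gen_choiceMixin finite_measures.
HB.instance Definition _ :=
  isPointed.Build finite_measures
    (mzero : {finite_measure set (euclidean R d) -> \bar R}).

Definition bounded_continuous (g : euclidean R d -> R) : Prop :=
  continuous g /\ exists C, forall x, `|g x| <= C.

Definition integrate_bounded_continuous (mu : finite_measures) :
    prod_topology
      (fun _ : {g : euclidean R d -> R | bounded_continuous g} => R) :=
  fun g => \int[mu]_x sval g x.

(* Weak topology: the coarsest topology for which mu |-> \int g dmu is
   continuous for every bounded continuous g. *)
HB.instance Definition _ :=
  PointedTopological.copy finite_measures
    (initial_topology integrate_bounded_continuous).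

Definition measure_vectors (ell : nat) : Type :=
  prod_topology (fun _ : 'I_ell => finite_measures).

HB.instance Definition _ (ell : nat) :=
  Topological.copy (measure_vectors ell)
    (prod_topology (fun _ : 'I_ell => finite_measures)).
HB.instance Definition _ (ell : nat) :=
  Pointed.copy (measure_vectors ell) ('I_ell -> finite_measures).

Definition configurations (ell : nat) := borelType (measure_vectors ell).

End measure_spaces.

Section markov_processes.
Variables (R : realType) (E : ptopologicalType) (Omega : pointedType).
Variable X : R -> Omega -> borelType E.

Definition cylinders (I : set R) : set (set Omega) :=
  [set X s @^-1` B | s in I & B in @measurable _ (borelType E)].

Definition history (t : R) : set (set Omega) := <<s cylinders `[0, t] >>.

(* Omega with the sigma-algebra generated by the whole process. *)
Definition process_space : Type :=
  g_sigma_algebraType (cylinders [set s | 0 <= s]).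

HB.instance Definition _ :=
  Measurable.copy process_space
    (g_sigma_algebraType (cylinders [set s | 0 <= s])).

Definition stopping_time (T : Omega -> \bar R) : Prop :=
  (forall o, (0 <= T o)%E) /\
  (forall t, 0 <= t -> history t [set o | (T o <= t%:E)%E]).

Definition stopped_history (T : Omega -> \bar R) (G : set process_space) : Prop :=
  measurable G /\
  forall t, 0 <= t -> history t (G `&` [set o | (T o <= t%:E)%E]).

Definition right_continuous_paths : Prop :=
  forall o t, 0 <= t -> (X s o) @[s --> t^'+] --> (X t o : E).

Definition continuous_paths : Prop :=
  forall o, {within [set t | 0 <= t], continuous (fun t => X t o : E)}.

(* The last clause is P_x(X_{T+s} \in B | F_T) = P_{X_T}(X_s \in B) on
   {T < oo}, integrated over events G of F_T. *)
Record strong_markov (Pr : borelType E -> probability process_space R) : Prop :=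
  StrongMarkov {
    sm_initial : forall x B, measurable B -> Pr x (X 0 @^-1` B) = \d_x B ;
    sm_kernel : forall A, measurable A ->
      measurable_fun [set: borelType E] (Pr ^~ A) ;
    sm_stopped : forall T, stopping_time T -> forall B, measurable B ->
      stopped_history T
        [set o | (T o < +oo)%E /\ B (X (fine (T o)) o)] ;
    sm_markov : forall x T, stopping_time T ->
      forall s, 0 <= s -> forall G, stopped_history T G ->
      forall B, measurable B ->
        Pr x (G `&` [set o | (T o < +oo)%E /\ B (X (fine (T o) + s) o)]) =
        (\int[Pr x]_(o in G `&` [set o | (T o < +oo)%E])
           Pr (X (fine (T o)) o) (X s @^-1` B))%E
  }.

End markov_processes.

(* A diffusion is a strong Markov process with continuous paths; it is
   conservative when it never leaves R^d, i.e. has infinite lifetime. *)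
Definition conservative_diffusion (R : realType) (d : nat)
    (p : R -> R.-pker (euclidean R d) ~> (euclidean R d)) : Prop :=
  exists (Omega : pointedType) (xi : R -> Omega -> euclidean R d)
         (Q : euclidean R d -> probability (process_space xi) R),
    [/\ continuous_paths xi,
        strong_markov Q &
        forall t x B, 0 <= t -> measurable B -> p t x B = Q x (xi t @^-1` B)].

Section branching_mechanisms.
Variables (R : realType) (ell : nat).
Implicit Types (theta y : euclidean R ell) (B : 'M[R]_ell).
Implicit Types (Pi : 'I_ell -> {measure set (euclidean R ell) -> \bar R}).

Definition dotp (u v : 'cV[R]_ell) : R := \sum_j u j 0 * v j 0.

Definition orthant : set (euclidean R ell) := [set y | forall j, 0 <= y j 0].

(* |y|; the norm provided by the library on matrices is the sup norm. *)
Definition enorm (y : 'cV[R]_ell) : R := Num.sqrt (dotp y y).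

Record branching_parameters B (beta : 'I_ell -> R) Pi : Prop :=
  BranchingParameters {
    bp_offdiag : forall i j, i != j -> 0 <= B i j ;
    bp_beta : forall i, 0 <= beta i ;
    bp_supp : forall i, Pi i (~` (orthant `\ 0)) = 0%E ;
    bp_int : forall i,
      (\int[Pi i]_(y in orthant)
         (Num.min (enorm y) (enorm y ^+ 2) + \sum_(j | j != i) y j 0)%:E
       < +oo)%E
  }.

Definition mechanism B (beta : 'I_ell -> R) Pi (i : 'I_ell)
    (theta : 'cV[R]_ell) : R :=
  - dotp theta (B *m delta_mx i 0) + beta i * theta i 0 ^+ 2 +
  \int[Pi i]_(y in orthant) (expR (- dotp theta y) - 1 + theta i 0 * y i 0).

Definition branching_mechanism (psi : 'I_ell -> 'cV[R]_ell -> R) : Prop :=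
  exists B beta Pi, branching_parameters B beta Pi /\
    forall i theta, orthant theta -> psi i theta = mechanism B beta Pi i theta.

Definition Btilde B Pi : 'M[R]_ell :=
  \matrix_(i, j) (B i j +
    \int[Pi j]_(y in orthant) Num.max (y i 0 - (i == j)%:R) 0).

(* Simultaneously permuting rows and columns by s would bring A to block
   upper triangular form with square diagonal blocks of sizes k and ell - k. *)
Definition reducible (A : 'M[R]_ell) : Prop :=
  exists (s : 'S_ell) (k : nat), (0 < k < ell)%N /\
    forall i j : 'I_ell, (k <= i)%N -> (j < k)%N -> A (s i) (s j) = 0.

Definition irreducible_matrix (A : 'M[R]_ell) : Prop := ~ reducible A.

End branching_mechanisms.

Section superprocesses.
Variables (R : realType) (d ell : nat).
Local Notation functions := ('I_ell -> euclidean R d -> R).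
Local Notation kernels :=
  ('I_ell -> R -> R.-pker (euclidean R d) ~> (euclidean R d)).

Definition bounded_borel_nonneg (f : functions) : Prop :=
  forall i, [/\ measurable_fun setT (f i), forall x, 0 <= f i x &
                exists C, forall x, f i x <= C].

Definition pairing (f : functions) (mu : configurations R d ell) : R :=
  \sum_i \int[mu i]_x f i x.

Definition total_mass (mu : configurations R d ell) : R :=
  pairing (fun _ _ => 1) mu.

(* e_i delta_x *)
Definition point_mass (i : 'I_ell) (x : euclidean R d) : configurations R d ell :=
  fun j => if j == i then (\d_x : finite_measures R d)
           else (mzero : finite_measures R d).

Definition locally_bounded (v : R -> functions) : Prop :=
  forall T, 0 < T ->
    exists C, forall t i x, 0 <= t <= T -> `|v t i x| <= C.

(* Solutions range over nonnegative functions, since psi i is only meaningful on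
   the orthant; Borel measurability in (t, x) makes both integrals meaningful. *)
Record cumulant_solution (P : kernels) (psi : 'I_ell -> 'cV[R]_ell -> R)
    (f : functions) (v : R -> functions) : Prop := CumulantSolution {
  cs_nonneg : forall t i x, 0 <= t -> 0 <= v t i x ;
  cs_measurable : forall i,
    measurable_fun [set tx : R * euclidean R d | 0 <= tx.1]
      (fun tx => v tx.1 i tx.2) ;
  cs_locally_bounded : locally_bounded v ;
  cs_equation : forall t i x, 0 <= t ->
    v t i x = \int[P i t x]_y f i y -
      \int[lebesgue_measure]_(s in `[0, t])
        \int[P i s x]_y psi i (\col_j v (t - s) j y)
}.

Definition unique_cumulant_solution (P : kernels)
    (psi : 'I_ell -> 'cV[R]_ell -> R) (f : functions) (v : R -> functions) : Prop :=
  cumulant_solution P psi f v /\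
  forall v', cumulant_solution P psi f v' ->
    forall t i x, 0 <= t -> v' t i x = v t i x.

Record superprocess (P : kernels) (psi : 'I_ell -> 'cV[R]_ell -> R)
    (V : R -> functions -> functions) (Omega : pointedType)
    (X : R -> Omega -> configurations R d ell)
    (Pr : configurations R d ell -> probability (process_space X) R) : Prop :=
  Superprocess {
    sp_diffusion : forall i, conservative_diffusion (P i) ;
    sp_mechanism : branching_mechanism psi ;
    sp_paths : right_continuous_paths X ;
    sp_markov : strong_markov Pr ;
    sp_cumulant : forall f, bounded_borel_nonneg f ->
      unique_cumulant_solution P psi f (fun t => V t f) ;
    sp_laplace : forall mu f t, bounded_borel_nonneg f -> 0 <= t ->
      'E_(Pr mu)[fun o => expR (- pairing f (X t o))]%E =
      (expR (- pairing (V t f) mu))%:E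
  }.

Section extinction.
Variables (Omega : pointedType) (X : R -> Omega -> configurations R d ell).

Definition extinction : set (process_space X) :=
  [set o | exists2 t, 0 < t & total_mass (X t o) = 0].

Definition extinction_exponent
    (Pr : configurations R d ell -> probability (process_space X) R)
    (x : euclidean R d) (i : 'I_ell) : \bar R :=
  (- lne (Pr (point_mass i x) extinction))%E.

End extinction.

Definition dual_mechanism (psi : 'I_ell -> 'cV[R]_ell -> R) (w : 'cV[R]_ell) :
    'I_ell -> 'cV[R]_ell -> R :=
  fun i lambda => psi i (lambda + w).

Definition dual_cumulant (V : R -> functions -> functions) (w : 'cV[R]_ell) :
    R -> functions -> functions :=
  fun t f i x => V t (fun j y => f j y + w j 0) i x - w i 0.

End superprocesses.

Arguments extinction {R d ell Omega} X _.

(* Main.v *)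
From HB Require Import structures.
Require Import Defs.
From mathcomp Require Import all_boot all_order all_algebra.
From mathcomp Require Import all_classical all_reals all_analysis.
From mathcomp Require Import measurable_realfun ring lra.

Set Implicit Arguments.
Unset Strict Implicit.
Unset Printing Implicit Defensive.

Import Order.TTheory GRing.Theory Num.Theory.
Import numFieldNormedType.Exports.

(** The heart of the matter is the formula Pr_mu (extinction) = exp(- <w, mu>)
for every starting configuration mu; once it is known, conditioning on
extinction is an h-transform with h = exp(- <w, .>).

Three facts give the formula. First, spatially constant data have spatially
constant cumulants [cumulant_solution_spatially_constant]: conservativity makes
the linear term of the equation constant, and the mechanism is Lipschitz on
bounded sets, so a Gronwall argument shows that the spatial oscillation of the
solution vanishes. Hence the law of the total mass at a given time depends on mu
through the masses of its components only. Second, the zero configuration is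
absorbing, almost surely and for all times at once [absorption]: started from a
small mass, the process is unlikely to have a large mass later, and the Markov
property at the first time of a fine grid at which the mass is small turns this
into a statement about paths. Thus extinction is, up to a null event, the
increasing union of the events that the mass vanishes at time n. Third, the
probability that the mass vanishes at time t is the limit of
E exp(- c |X_t|) for large c; the exponent being linear in the component masses,
this limit is a product of powers of the corresponding probabilities for
e_i delta_x [dead_probability], and so is the extinction probability
[extinction_probability].

Since extinction of the path after a stopping time T is extinction of the path,
up to a null event, the strong Markov property holds for events intersected with
extinction [strong_markov_extinction], and conditioning on the past of T replaces
the indicator of extinction by exp(- <w, X_T>)
[strong_markov_extinction_integral]. At a fixed time t this reads
E[exp(- <f, X_t>); extinction] = exp(- <V_t (f + w), mu>) [laplace_extinction],
and dividing by exp(- <w, mu>) gives the Laplace functional of the conditioned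
process.

Taking f = 0 gives V_t w = w [V_extinction_exponent], so the equation for V_t w
reduces to psi(i, w) = 0 [mechanism_root]. Because psi vanishes at w, the
function psi(i, . + w) has no constant term and is again a branching mechanism:
the jump measure is tilted by exp(- [w, y]) and only the diagonal of the drift
matrix changes [dual_branching_mechanism]. Translation by w maps solutions of the
dual equation to solutions of the original one, whence uniqueness, and the
difference V_t (f + w) - w is nonnegative because V_t (f + w) >= V_t w = w
[dual_unique_cumulant_solution]. Finally the conditioned laws inherit the strong
Markov property, as every h-transform does [extinct_process_strong_markov]. *)

Local Open Scope classical_set_scope.
Local Open Scope ring_scope.

(** * Borel measurability in Euclidean space *)

Lemma continuous_borel_measurable (R : realType) (E : ptopologicalType)
    (g : E -> R) :
  continuous g -> measurable_fun [set: borelType E] (g : borelType E -> R).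
Proof.
move=> cg; apply: (measurability _ (RGenOpens.measurableE R)).
move=> _ [_ [a [b ->]] <-]; rewrite setTI; apply: sub_sigma_algebra.
by move/continuousP: cg; apply; exact: interval_open.
Qed.

Lemma measurable_coord (R : realType) (n : nat) (i : 'I_n) :
  measurable_fun [set: euclidean R n] (fun y : euclidean R n => y i 0).
Proof.
exact: (continuous_borel_measurable
  (E := ('cV[R]_n : ptopologicalType)) (@coord_continuous R n 1 i 0)).
Qed.

(** An open set is a countable union of boxes with rational centres and radii
    1/(k+1), and membership in a box is a condition on the coordinates. *)
Lemma measurable_coordinatewise (R : realType) (n : nat) d
    (T : measurableType d) (D : set T) (f : T -> euclidean R n) :
  measurable D ->
  (forall i, measurable_fun D (fun x => f x i 0)) -> measurable_fun D f.
Proof.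
move=> mD mf; apply: (@measurability _ _ _ _ D f (@open ('cV[R]_n : ptopologicalType))) => //.
move=> _ [U oU <-].
pose boxes := [set qk : 'cV[rat]_n * nat |
  ball (map_mx ratr qk.1 : 'cV[R]_n) qk.2.+1%:R^-1 `<=` U].
have -> : f @^-1` U = \bigcup_(qk : 'cV[rat]_n * nat)
    [set x | boxes qk /\
       forall i, `|ratr (qk.1 i 0) - f x i 0| < qk.2.+1%:R^-1].
  apply/seteqP; split => [x Ufx|x [[q k] _ /= [sub h]]].
    have /nbhs_ballP[e /= e0 se] : nbhs (f x : 'cV[R]_n) U by exact: open_nbhs_nbhs.
    have [k _ /(_ k (leqnn k)) ke] := near_infty_natSinv_lt (PosNum (divr_gt0 e0 (ltr0n R 2))).
    rewrite /= in ke.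
    have : forall i, exists q : rat, `|ratr q - f x i 0| < k.+1%:R^-1.
      move=> i.
      have : f x i 0 - k.+1%:R^-1 < f x i 0 + k.+1%:R^-1.
        by rewrite ltrBlDr -addrA ltrDl addr_gt0// invr_gt0 ltr0n.
      move=> /rat_in_itvoo[q]; rewrite in_itv/= => /andP[q1 q2].
      by exists q; rewrite ltr_distl q1.
    move=> /choice[q qP].
    exists (\col_i q i, k) => //=; split; last by move=> i; rewrite mxE.
    move=> y; rewrite /ball/= => -[_ hy]; apply: se; split => // i j.
    have := hy i j; have := qP i; rewrite /ball/= !mxE !ord1.
    move: (ratr (q i)) ke => b; move: (k.+1%:R^-1) => c ke.
    rewrite !ltr_norml => /andP[? ?] /andP[? ?]; apply/andP; split; lra.
  by apply: sub; rewrite /ball/=; split => [|i j]; rewrite ?invr_gt0// !mxE ord1; exact: h.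
rewrite setI_bigcupr; apply: countable_bigcupT_measurable; first exact: countableP.
move=> [q k]; have [bq|bq] := pselect (boxes (q, k)); last first.
  rewrite (_ : _ `&` _ = set0)//.
  by rewrite -subset0 => x [_ []].
rewrite (_ : _ `&` _ = \bigcap_(i in [set: 'I_n])
    (D `&` [set x | `|ratr (q i 0) - f x i 0| < k.+1%:R^-1]) `&` D); last first.
  apply/seteqP; split => [x [Dx [_ h]]|x [h Dx]].
    by split => // i _; split => //; exact: h.
  by split => //; split => // i; have [] := h i I.
apply: measurableI => //; apply: fin_bigcap_measurable => // i _.
have mg : measurable_fun D (fun x => `|ratr (q i 0) - f x i 0|).
  apply: measurableT_comp => //; apply: measurable_funB => //.
rewrite (_ : [set x | _] = (fun x => `|ratr (q i 0) - f x i 0|) @^-1` `]-oo, k.+1%:R^-1[ ).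
  by apply: mg.
by apply/seteqP; split => x /=; rewrite in_itv.
Qed.

Lemma measurable_nonneg_times (R : realType) d (T : measurableType d) :
  measurable [set p : R * T | 0 <= p.1].
Proof.
rewrite (_ : [set _ | _] = `[0, +oo[ `*` setT); first exact: measurableX.
by apply/seteqP; split => -[s o] /=; rewrite in_itv/= andbT; tauto.
Qed.

Lemma measurable_time_strip (R : realType) d (T : measurableType d) (t : R) :
  measurable [set p : R * T | 0 <= p.1 <= t].
Proof.
rewrite (_ : [set _ | _] = `[0, t] `*` setT); first exact: measurableX.
by apply/seteqP; split => -[s o] /=; rewrite in_itv/=; tauto.
Qed.

Lemma truncn_approx_cvg (R : realType) (s : R) : 0 <= s ->
  (Num.truncn (s * k.+1%:R))%:R / k.+1%:R @[k --> \oo] --> s.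
Proof.
move=> s0; apply/cvgrPdist_lt => e e0.
near=> k.
have k0 : 0 < k.+1%:R :> R by rewrite ltr0n.
have /truncn_itv /andP[l u] : 0 <= s * k.+1%:R by rewrite mulr_ge0.
have ke : k.+1%:R^-1 < e by near: k; exact: (near_infty_natSinv_lt (PosNum e0)).
have l1 : (Num.truncn (s * k.+1%:R))%:R / k.+1%:R <= s by rewrite ler_pdivrMr.
rewrite ger0_norm ?subr_ge0//; apply: le_lt_trans ke.
rewrite lerBlDl -[X in _ + X]mul1r -mulrDl ler_pdivlMr// natr1.
exact: ltW.
Unshelve. all: by end_near.
Qed.

(** Reading the path at the last multiple of 1/(k+1) before t gives processes that
    are jointly measurable, being constant in time between grid points, and that
    converge to the process by continuity of the paths. *)
Lemma measurable_process (R : realType) (n : nat) d (O : measurableType d)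
    (xi : R -> O -> euclidean R n) :
  (forall t, 0 <= t -> measurable_fun setT (xi t)) ->
  (forall o, {within [set t | 0 <= t],
    continuous (fun t => xi t o : 'cV[R]_n)}) ->
  measurable_fun [set p : R * O | 0 <= p.1] (fun p => xi p.1 p.2).
Proof.
move=> mxi cxi.
have mD := @measurable_nonneg_times R _ O.
apply: measurable_coordinatewise => // i.
apply: (@measurable_fun_cvg _ _ _ _ (fun k (p : R * O) =>
    xi ((Num.truncn (p.1 * k.+1%:R))%:R / k.+1%:R) p.2 i 0)); last first.
  move=> [s o] /= s0.
  pose u k := (Num.truncn (s * k.+1%:R))%:R / k.+1%:R : R.
  have cu : u k @[k --> \oo] --> within [set t | 0 <= t] (nbhs s).
    move=> A; rewrite nbhs_filterE/= => wA.
    have := truncn_approx_cvg s0 => /(_ _ wA) [N _ NA].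
    by exists N => // k /NA; apply; exact: divr_ge0.
  have cxu : xi (u k) o @[k --> \oo] --> (xi s o : 'cV[R]_n).
    apply: (@cvg_comp _ _ _ u (fun t => xi t o : 'cV[R]_n) _ _ _ cu).
    by have /subspace_continuousP := cxi o; apply.
  apply: (@cvg_comp _ _ _ _ (fun M : 'cV[R]_n => M i 0) _ _ _ cxu).
  exact: (@coord_continuous R n 1 i 0).
move=> k.
have k0 : 0 < k.+1%:R :> R by rewrite ltr0n.
rewrite (_ : [set p : R * O | _] = \bigcup_j
    (`[j%:R / k.+1%:R, j.+1%:R / k.+1%:R[%classic `*` [set: O])); last first.
  apply/seteqP; split => [[s o] /= s0|[s o] [j _ /= [+ _]]].
    have /truncn_itv /andP[l u] : 0 <= s * k.+1%:R by rewrite mulr_ge0.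
    exists (Num.truncn (s * k.+1%:R)) => //=; split => //.
    by rewrite in_itv/= ler_pdivrMr// l ltr_pdivlMr.
  by rewrite in_itv/= => /andP[+ _]; apply: le_trans; rewrite divr_ge0.
apply/measurable_fun_bigcup => [j|j]; first exact: measurableX.
apply: (eq_measurable_fun (fun p : R * O => xi (j%:R / k.+1%:R) p.2 i 0)).
  move=> [s o]; rewrite inE/= in_itv/= => -[/andP[]]; rewrite ler_pdivrMr// ltr_pdivlMr//.
  by move=> l u _; rewrite (@truncn_def _ _ j)// l u.
apply: (@measurable_funS _ _ _ _ setT) => //.
apply: (@measurable_comp _ _ _ _ _ _ setT (fun o => xi (j%:R / k.+1%:R) o i 0)) => //.
apply: (@measurable_comp _ _ _ _ _ _ setT (fun y : euclidean R n => y i 0)) => //.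
  exact: measurable_coord.
by apply: mxi; rewrite divr_ge0.
Qed.

(** * Branching mechanisms *)

Lemma normr_Rintegral_le d (T : measurableType d) (R : realType)
    (mu : {measure set T -> \bar R}) (D : set T) (f g : T -> R) :
  measurable D -> mu.-integrable D (EFin \o f) -> mu.-integrable D (EFin \o g) ->
  (forall x, D x -> `|f x| <= g x) ->
  `|\int[mu]_(x in D) f x| <= \int[mu]_(x in D) g x.
Proof.
move=> mD fi gi fg; apply: le_trans (le_normr_Rintegral mD fi) _.
by apply: le_Rintegral => //; exact: integrable_norm.
Qed.

(** The derivative 1 - exp(- s) of exp(- s) + s lies between 0 and min(1, s). The
    bound min(1, K) for the slope keeps track of the quadratic behaviour at 0 and
    of the linear behaviour at infinity. *)
Lemma expRN_compensated (R : realType) (a b K : R) :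
  0 <= a -> a <= b -> b <= K ->
  0 <= expR (- b) - expR (- a) + (b - a) <= (b - a) * Num.min 1 K.
Proof.
move=> a0 ab bK.
have h1 : expR (- a) - expR (- b) <= b - a.
  have -> : expR (- b) = expR (- a) * expR (- (b - a)).
    by rewrite -expRD; congr expR; ring.
  have := expR_ge1Dx (- (b - a)).
  have := expR_gt0 (- a).
  have : expR (- a) <= 1 by rewrite expR_le1 oppr_le0.
  have : 0 <= b - a by rewrite subr_ge0.
  move: (expR (- a)) (expR (- (b - a))) (b - a) => p q r.
  by move=> ? ? ? ?; nra.
have h2 : expR (- b) <= expR (- a) by rewrite ler_expR lerN2.
have h3 : (1 - b) * (b - a) <= expR (- a) - expR (- b).
  have -> : expR (- a) = expR (- b) * expR (b - a).
    by rewrite -expRD; congr expR; ring.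
  have := expR_ge1Dx (- b).
  have := expR_ge1Dx (b - a).
  have := expR_gt0 (- b).
  have : 0 <= b - a by rewrite subr_ge0.
  move: (expR (- b)) (expR (b - a)) => p q.
  move: (b - a) => r ? ? ? ?; nra.
apply/andP; split; first lra.
by have [K1|K1] := leP 1 K; nra.
Qed.

Section mechanism.
Variables (R : realType) (ell : nat).
Implicit Types (theta y : euclidean R ell) (i j : 'I_ell).

Definition compensated_exp i theta y : R :=
  expR (- dotp theta y) - 1 + theta i 0 * y i 0.

Definition jump_weight i y : R :=
  Num.min (enorm y) (enorm y ^+ 2) + \sum_(j | j != i) y j 0.

Lemma dotp_ge0 theta y : orthant theta -> orthant y -> 0 <= dotp theta y.
Proof. by move=> t0 y0; apply: sumr_ge0 => j _; rewrite mulr_ge0. Qed.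

Lemma enorm_ge0 y : 0 <= enorm y.
Proof. exact: sqrtr_ge0. Qed.

Lemma coord_le_enorm y j : orthant y -> y j 0 <= enorm y.
Proof.
move=> y0; rewrite -[leLHS](ger0_norm (y0 j)) -sqrtr_sqr /enorm ler_wsqrtr//.
rewrite /dotp (bigD1 j)//= expr2 lerDl; apply: sumr_ge0 => k _.
by rewrite mulr_ge0.
Qed.

Lemma sum_coord_le_enorm y : orthant y -> \sum_j y j 0 <= ell%:R * enorm y.
Proof.
move=> y0; rewrite (_ : ell%:R * _ = \sum_(j < ell) enorm y).
  by apply: ler_sum => j _; exact: coord_le_enorm.
by rewrite sumr_const card_ord mulr_natl.
Qed.

Lemma jump_weight_ge0 i y : orthant y -> 0 <= jump_weight i y.
Proof.
move=> y0; rewrite addr_ge0//; last exact: sumr_ge0.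
by rewrite le_min enorm_ge0 exprn_ge0// enorm_ge0.
Qed.

Definition lipschitz_factor (K : R) : R := ell%:R * (1 + K * ell%:R) + 1.

Lemma lipschitz_factor_ge0 K : 0 <= K -> 0 <= lipschitz_factor K.
Proof. by move=> K0; rewrite addr_ge0// mulr_ge0// addr_ge0// mulr_ge0. Qed.

Lemma min_mul_le (r c : R) : 0 <= r -> 0 <= c ->
  r * Num.min 1 (c * r) <= (1 + c) * Num.min r (r ^+ 2).
Proof.
move=> r0 c0; rewrite !minr_pMr//; last by rewrite addr_ge0.
rewrite le_min; apply/andP; split.
  by rewrite ge_min; apply/orP; left; nra.
by rewrite ge_min; apply/orP; right; nra.
Qed.

(** The pairings [theta, y] and [theta', y] are at most K times the sum S of the
    coordinates of y, so the second-order part is controlled by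
    S min(1, K S), hence by the minimum of |y| and |y|^2; together with the
    coordinates other than i this is what the jump measure integrates. *)
Lemma compensated_exp_lipschitz (K delta : R) i theta theta' y :
  orthant theta -> orthant theta' -> orthant y ->
  0 <= K -> (forall j, theta j 0 <= K) -> (forall j, theta' j 0 <= K) ->
  (forall j, `|theta j 0 - theta' j 0| <= delta) ->
  `|compensated_exp i theta y - compensated_exp i theta' y| <=
    delta * (lipschitz_factor K * jump_weight i y).
Proof.
move=> t0 t'0 y0 K0 tK t'K tt'.
have d0 : 0 <= delta by exact: le_trans (normr_ge0 _) (tt' i).
set S := \sum_j y j 0.
have S0 : 0 <= S by exact: sumr_ge0.
have SK : forall th : euclidean R ell, (forall j, th j 0 <= K) -> dotp th y <= K * S.
  by move=> th thK; rewrite mulr_sumr; apply: ler_sum => j _; rewrite ler_wpM2r.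
set a := dotp theta y; set b := dotp theta' y.
have a0 : 0 <= a by exact: dotp_ge0.
have b0 : 0 <= b by exact: dotp_ge0.
have abE : a - b = \sum_j (theta j 0 - theta' j 0) * y j 0.
  by rewrite -sumrB; apply: eq_bigr => j _; rewrite mulrBl.
have abS : `|a - b| <= delta * S.
  rewrite abE; apply: le_trans (ler_norm_sum _ _ _) _.
  rewrite mulr_sumr; apply: ler_sum => j _.
  by rewrite normrM (ger0_norm (y0 j)) ler_wpM2r.
(* Adding and subtracting a - b isolates the second-order part of the
   exponential; the coordinate i of the compensator then cancels. *)
have -> : compensated_exp i theta y - compensated_exp i theta' y =
    (expR (- a) - expR (- b) + (a - b)) -
    \sum_(j | j != i) (theta j 0 - theta' j 0) * y j 0.
  rewrite /compensated_exp -/a -/b abE (bigD1 i)//=; ring.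
have h1 : `|expR (- a) - expR (- b) + (a - b)| <= `|a - b| * Num.min 1 (K * S).
  have [ab|ab] := leP a b.
    have /andP[l u] := expRN_compensated a0 ab (SK _ t'K).
    rewrite -normrN (_ : - (_ - _ + _) = expR (- b) - expR (- a) + (b - a)); last by ring.
    by rewrite ger0_norm// distrC (ger0_norm (_ : 0 <= b - a))// subr_ge0.
  have /andP[l u] := expRN_compensated b0 (ltW ab) (SK _ tK).
  by rewrite ger0_norm// (ger0_norm (_ : 0 <= a - b))// subr_ge0 ltW.
have h2 : `|\sum_(j | j != i) (theta j 0 - theta' j 0) * y j 0| <=
    delta * \sum_(j | j != i) y j 0.
  apply: le_trans (ler_norm_sum _ _ _) _.
  rewrite mulr_sumr; apply: ler_sum => j _.
  by rewrite normrM (ger0_norm (y0 j)) ler_wpM2r.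
apply: le_trans (ler_normB _ _) _; apply: le_trans (lerD h1 h2) _.
have h3 : S * Num.min 1 (K * S) <=
    ell%:R * (1 + K * ell%:R) * Num.min (enorm y) (enorm y ^+ 2).
  apply: (@le_trans _ _ (ell%:R * enorm y * Num.min 1 ((K * ell%:R) * enorm y))).
    apply: ler_pM => //; first by rewrite le_min ler01 mulr_ge0.
      exact: sum_coord_le_enorm.
    rewrite le_min !ge_min lexx/= -mulrA ler_wpM2l ?orbT//.
    exact: sum_coord_le_enorm.
  rewrite -!mulrA ler_wpM2l// !mulrA; apply: min_mul_le; first exact: enorm_ge0.
  by rewrite mulr_ge0.
have m0 : 0 <= Num.min 1 (K * S) by rewrite le_min ler01 mulr_ge0.
have s0 : 0 <= \sum_(j | j != i) y j 0 by exact: sumr_ge0.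
have n0 : 0 <= Num.min (enorm y) (enorm y ^+ 2).
  by rewrite le_min enorm_ge0 exprn_ge0// enorm_ge0.
apply: (@le_trans _ _ (delta * S * Num.min 1 (K * S) +
    delta * \sum_(j | j != i) y j 0)); first by rewrite lerD2r ler_wpM2r.
rewrite -mulrA -mulrDr ler_wpM2l// /jump_weight /lipschitz_factor.
have c0 : 0 <= ell%:R * (1 + K * ell%:R) :> R by rewrite mulr_ge0// addr_ge0// mulr_ge0.
move: c0 h3; set c := ell%:R * (1 + K * ell%:R); set v := Num.min (enorm y) _ in n0 *.
set z := \sum_(j | _) _ in s0 *; set u := S * _.
by move=> c0 h3; have := mulr_ge0 c0 s0; lra.
Qed.

Lemma measurable_orthant : measurable (@orthant R ell).
Proof.
rewrite (_ : @orthant R ell = \bigcap_(j in [set: 'I_ell])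
    ((fun y : euclidean R ell => y j 0) @^-1` `[0, +oo[)).
  apply: fin_bigcap_measurable => // j _; rewrite -[X in measurable X]setTI.
  exact: measurable_coord.
apply/seteqP; split => y /= y0 j; first by rewrite /= in_itv/= andbT.
by have := y0 j I; rewrite /= in_itv/= andbT.
Qed.

Lemma measurable_dotp theta : measurable_fun setT (dotp theta : euclidean R ell -> R).
Proof.
apply: measurable_sum => j; apply: measurable_funM => //; exact: measurable_coord.
Qed.

Lemma measurable_enorm : measurable_fun setT (@enorm R ell : euclidean R ell -> R).
Proof.
apply: (@measurableT_comp _ _ _ _ _ _ (@Num.sqrt R)).
  by apply: continuous_measurable_fun; exact: sqrt_continuous.
by apply: measurable_sum => j; apply: measurable_funM; exact: measurable_coord.
Qed.

Lemma measurable_compensated_exp i theta : measurable_fun setT (compensated_exp i theta).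
Proof.
apply: measurable_funD; last by apply: measurable_funM => //; exact: measurable_coord.
apply: measurable_funB => //; apply: measurableT_comp => //.
by apply: measurable_funN; exact: measurable_dotp.
Qed.

Lemma measurable_jump_weight i : measurable_fun setT (jump_weight i).
Proof.
apply: measurable_funD.
  apply: measurable_minr; first exact: measurable_enorm.
  by apply: measurable_funX; exact: measurable_enorm.
rewrite (_ : (fun y : euclidean R ell => _) =
  (fun y : euclidean R ell => \sum_(j <- [seq j <- index_enum 'I_ell | j != i]) y j 0)).
  by apply: measurable_sum => j; exact: measurable_coord.
by apply/funext => y; rewrite big_filter.
Qed.

Variables (B : 'M[R]_ell) (beta : 'I_ell -> R).
Variable Pi : 'I_ell -> {measure set (euclidean R ell) -> \bar R}.
Hypothesis bp : branching_parameters B beta Pi.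

Lemma integrable_jump_weight i : (Pi i).-integrable (@orthant R ell) (EFin \o jump_weight i).
Proof.
apply/integrableP; split.
  apply/measurable_EFinP; apply: measurable_funTS; exact: measurable_jump_weight.
rewrite (eq_integral (fun y => (jump_weight i y)%:E)); first exact: (bp_int bp i).
move=> y; rewrite inE => y0 /=; rewrite ger0_norm//; exact: jump_weight_ge0.
Qed.

Lemma integrable_compensated_exp i theta : orthant theta ->
  (Pi i).-integrable (@orthant R ell) (EFin \o compensated_exp i theta).
Proof.
move=> t0; set K := \sum_j theta j 0.
have K0 : 0 <= K by exact: sumr_ge0.
have tK j : theta j 0 <= K.
  by rewrite /K (bigD1 j)//= lerDl; exact: sumr_ge0.
apply: (@le_integrable _ _ _ _ _ measurable_orthant _
  (fun y => (K * lipschitz_factor K)%:E * (EFin \o jump_weight i) y)%E).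
- by apply/measurable_EFinP; apply: measurable_funTS; exact: measurable_compensated_exp.
- move=> y y0 /=; rewrite lee_fin.
  rewrite [leRHS]ger0_norm; last first.
    rewrite mulr_ge0//; last exact: jump_weight_ge0.
    by rewrite mulr_ge0//; exact: lipschitz_factor_ge0.
  have := @compensated_exp_lipschitz K K i theta (0 : 'cV[R]_ell) y t0 _ y0 K0 tK.
  rewrite {2}/compensated_exp (_ : dotp 0 y = 0); last first.
    by apply: big1 => j _; rewrite mxE mul0r.
  rewrite mxE mul0r addr0 oppr0 expR0 subrr subr0 -mulrA; apply.
  + by move=> j; rewrite mxE.
  + by move=> j; rewrite mxE.
  + by move=> j; rewrite mxE subr0 ger0_norm.
- by apply: integrableZl; [exact: measurable_orthant|exact: integrable_jump_weight].
Qed.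

Lemma mechanism_lipschitz (K : R) : 0 <= K -> exists2 L, 0 <= L &
  forall i theta theta' (delta : R), orthant theta -> orthant theta' ->
    (forall j, theta j 0 <= K) -> (forall j, theta' j 0 <= K) ->
    (forall j, `|theta j 0 - theta' j 0| <= delta) ->
    `|mechanism B beta Pi i theta - mechanism B beta Pi i theta'| <= L * delta.
Proof.
move=> K0.
pose G i := \int[Pi i]_(y in @orthant R ell) jump_weight i y.
have G0 i : 0 <= G i by apply: Rintegral_ge0 => y; exact: jump_weight_ge0.
pose L i := \sum_j `|(B *m delta_mx i 0) j (0 : 'I_1)| + 2 * K * beta i +
  lipschitz_factor K * G i.
have L0 i : 0 <= L i.
  rewrite !addr_ge0//; first exact: sumr_ge0.
    by rewrite mulr_ge0 ?(bp_beta bp)// mulr_ge0.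
  by rewrite mulr_ge0//; exact: lipschitz_factor_ge0.
exists (\sum_i L i); first exact: sumr_ge0.
move=> i t t' delta t0 t'0 tK t'K tt'.
have d0 : 0 <= delta by exact: le_trans (normr_ge0 _) (tt' i).
apply: (@le_trans _ _ (L i * delta)); last first.
  by rewrite ler_wpM2r// (bigD1 i)//= lerDl; exact: sumr_ge0.
have it := integrable_compensated_exp i t0.
have it' := integrable_compensated_exp i t'0.
have -> : mechanism B beta Pi i t - mechanism B beta Pi i t' =
    - (dotp t (B *m delta_mx i 0) - dotp t' (B *m delta_mx i 0)) +
    beta i * (t i 0 ^+ 2 - t' i 0 ^+ 2) +
    \int[Pi i]_(y in @orthant R ell) (compensated_exp i t y - compensated_exp i t' y).
  rewrite RintegralB//; last exact: measurable_orthant.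
  by rewrite /mechanism /compensated_exp; ring.
rewrite /L 2!mulrDl; apply: le_trans (ler_normD _ _) (lerD _ _).
  apply: le_trans (ler_normD _ _) (lerD _ _).
    rewrite normrN -sumrB mulr_suml; apply: le_trans (ler_norm_sum _ _ _) _.
    by apply: ler_sum => j _; rewrite -mulrBl normrM mulrC ler_wpM2l.
  have sq : `|t i 0 ^+ 2 - t' i 0 ^+ 2| <= 2 * K * delta.
    rewrite subr_sqr normrM [X in _ * X]ger0_norm ?addr_ge0// mulrC.
    apply: ler_pM => //; first by rewrite addr_ge0.
    by rewrite mulrDl mul1r lerD.
  rewrite normrM (ger0_norm (bp_beta bp i)).
  apply: le_trans (ler_wpM2l (bp_beta bp i) sq) _.
  by rewrite le_eqVlt; apply/orP; left; apply/eqP; ring.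
apply: le_trans.
  apply: (normr_Rintegral_le
    (g := fun y => delta * lipschitz_factor K * jump_weight i y)).
  - exact: measurable_orthant.
  - exact: (integrableB measurable_orthant it it').
  - exact: (integrableZl measurable_orthant _ (integrable_jump_weight i)).
  - move=> y y0; rewrite -mulrA.
    exact: compensated_exp_lipschitz.
rewrite RintegralZl//; last exact: integrable_jump_weight.
  by rewrite -/(G i) le_eqVlt; apply/orP; left; apply/eqP; ring.
exact: measurable_orthant.
Qed.

(** Precomposing the mechanism with the coordinatewise absolute value extends it
    from the orthant, where it is locally Lipschitz, to a continuous function on
    the whole space. *)
Lemma measurable_mechanism_comp d (T : measurableType d) (D : set T) i
    (v : T -> euclidean R ell) :
  measurable D -> (forall j, measurable_fun D (fun x => v x j 0)) ->
  (forall x, D x -> orthant (v x)) ->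
  measurable_fun D (fun x => mechanism B beta Pi i (v x)).
Proof.
move=> mD mv v0.
pose ext (theta : euclidean R ell) : R :=
  mechanism B beta Pi i (\col_j `|theta j 0|).
have cext : continuous (ext : 'cV[R]_ell -> R).
  move=> t; pose K := 1 + \sum_j `|t j 0|.
  have K0 : 0 <= K by rewrite addr_ge0// sumr_ge0.
  have tK j : `|t j 0| + 1 <= K.
    by rewrite addrC lerD2l (bigD1 j)//= lerDl; exact: sumr_ge0.
  have [L L0 hL] := mechanism_lipschitz K0.
  apply/(@cvgrPdist_lt _ _ _ _ (nbhs_filter (t : 'cV[R]_ell))) => e e0.
  pose delta := Num.min 1 (e / (L + 1)).
  have L1 : 0 < L + 1 by rewrite ltr_wpDl.
  have d0 : 0 < delta by rewrite lt_min ltr01 divr_gt0.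
  have : nbhs (t : 'cV[R]_ell) (ball t delta) by exact: nbhsx_ballx.
  apply: (@filterS _ _ (nbhs_filter (t : 'cV[R]_ell))) => t' [_ /(_ _ 0) tt'].
  apply: (@le_lt_trans _ _ (L * delta)).
    apply: hL.
    - by move=> j; rewrite mxE.
    - by move=> j; rewrite mxE.
    - by move=> j; rewrite mxE; apply: le_trans (tK j); rewrite lerDl.
    - move=> j; rewrite mxE; apply: le_trans (tK j).
      rewrite -lerBlDl; apply: le_trans (lerB_dist _ _) _.
      by rewrite distrC (le_trans (ltW (tt' j)))// ge_min lexx.
    - move=> j; rewrite !mxE; apply: le_trans (ltW (tt' j)).
      exact: ler_dist_dist.
  apply: (@le_lt_trans _ _ (L * (e / (L + 1)))).
    by rewrite ler_wpM2l// ge_min lexx orbT.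
  by rewrite mulrCA gtr_pMr// ltr_pdivrMr// mul1r ltrDl.
apply: (eq_measurable_fun (ext \o v)).
  move=> x; rewrite inE => Dx /=; rewrite /ext; congr mechanism.
  by apply/matrixP => j k; rewrite mxE ord1 ger0_norm//; exact: v0.
apply: (measurableT_comp
  (continuous_borel_measurable (E := ('cV[R]_ell : ptopologicalType)) cext)).
exact: measurable_coordinatewise.
Qed.

End mechanism.

(** * Mixtures and weighted measures *)

Import HBNNSimple.

(** Turns identities between measures of sets into identities between integrals.
    Neither m nor the measures K x need be finite, so that changes of density for
    jump measures and disintegrations of path laws are both instances. *)
Lemma ge0_integral_mixture d1 d2 (T1 : measurableType d1) (T2 : measurableType d2)
    (R : realType) (m : {measure set T1 -> \bar R})
    (K : T1 -> {measure set T2 -> \bar R}) (nu : {measure set T2 -> \bar R})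
    (f : T2 -> \bar R) :
  (forall U, measurable U -> measurable_fun setT (K ^~ U)) ->
  (forall U, measurable U -> nu U = (\int[m]_x K x U)%E) ->
  (forall y, (0 <= f y)%E) -> measurable_fun setT f ->
  (\int[nu]_y f y = \int[m]_x \int[K x]_y f y)%E.
Proof.
move=> mK nuE f0 mf; pose f_ := nnsfun_approx measurableT mf.
have mKf (g : {nnsfun T2 >-> R}) : measurable_fun setT (fun x => \int[K x]_y (g y)%:E)%E.
  apply: measurable_fun_integral_kernel => //; first by move=> z; rewrite lee_fin.
  exact/measurable_EFinP.
have simple (g : {nnsfun T2 >-> R}) :
    (\int[nu]_y (g y)%:E = \int[m]_x \int[K x]_y (g y)%:E)%E.
  have gE (mu : {measure set T2 -> \bar R}) : (\int[mu]_y (g y)%:E =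
      \sum_(r \in range g) (r%:E * mu (g @^-1` [set r])))%E.
    rewrite integralT_nnsfun sintegralE; apply: fsbig_widen => //.
    by move=> r [_ /= /preimage10 ->]; rewrite measure0 mule0.
  rewrite gE; under [RHS]eq_integral do rewrite gE.
  rewrite ge0_integral_fsum//.
  - apply: eq_fsbigr => r; rewrite inE => -[y _ <-].
    by rewrite ge0_integralZl// ?nuE//; [exact: mK|rewrite lee_fin].
  - by move=> r; apply: measurable_funeM; exact: mK.
  - move=> r x _; have [r0|r0] := leP 0 r; first by rewrite mule_ge0.
    by rewrite preimage_nnfun0// measure0 mule0.
have limE : f = (fun y => lim ((f_ n y)%:E @[n --> \oo])).
  by apply/funext => z; apply/esym/cvg_lim => //=; exact: cvg_nnsfun_approx.
have mono (mu : {measure set T2 -> \bar R}) :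
    ((\int[mu]_y (f_ n y)%:E)%E @[n --> \oo] --> (\int[mu]_y f y)%E).
  rewrite [in X in _ --> X]limE; apply: cvg_monotone_convergence => //.
  - by move=> n; exact/measurable_EFinP.
  - by move=> n z _; rewrite lee_fin.
  - by move=> z _ a b ab; rewrite lee_fin; exact/lefP/nd_nnsfun_approx.
apply: (cvg_unique _ (mono nu)) => //=.
rewrite (_ : (fun n => _) = (fun n => \int[m]_x \int[K x]_y (f_ n y)%:E)%E); last first.
  by apply/funext => n; exact: simple.
rewrite (_ : (\int[m]_x _)%E = (\int[m]_x lim ((\int[K x]_y (f_ n y)%:E)%E @[n --> \oo]))%E).
  apply: cvg_monotone_convergence => //.
  - by move=> n x _; apply: integral_ge0 => y _; rewrite lee_fin.
  - move=> x _ a b ab; apply: ge0_le_integral => //.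
    + by move=> y _; rewrite lee_fin.
    + exact/measurable_EFinP.
    + exact/measurable_EFinP.
    + by move=> z _; rewrite lee_fin; exact/lefP/nd_nnsfun_approx.
by apply: eq_integral => x _; apply/esym/cvg_lim => //; exact: mono.
Qed.

Section weighted_measure.
Context d (T : measurableType d) (R : realType).
Variables (mu : {measure set T -> \bar R}) (h : T -> R).
Hypotheses (mh : measurable_fun setT h) (h0 : forall x, 0 <= h x).

(** The proofs are arguments of the function so that its terms carry what the
    canonical measure structure below is built from. *)
Definition weighted_measure of measurable_fun setT h & (forall x, 0 <= h x) :=
  fun A : set T => (\int[mu]_(x in A) (h x)%:E)%E.

Local Notation wm := (weighted_measure mh h0).

Let wm0 : wm set0 = 0%E.
Proof. exact: integral_set0. Qed.

Let wm_ge0 A : (0 <= wm A)%E.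
Proof. by apply: integral_ge0 => x _; rewrite lee_fin. Qed.

Let wm_sigma : semi_sigma_additive wm.
Proof.
move=> F mF tF mUF; rewrite [X in _ --> X](_ : _ =
    \big[+%E/0%E]_(0 <= i <oo) wm (F i)).
  by apply: is_cvg_nneseries => n _ _; exact: wm_ge0.
rewrite /weighted_measure ge0_integral_bigcup//.
- by apply/measurable_EFinP; exact: measurable_funTS.
- by move=> x _; rewrite lee_fin.
Qed.

HB.instance Definition _ := isMeasure.Build _ _ _ wm wm0 wm_ge0 wm_sigma.

Lemma ge0_integral_weighted (f : T -> \bar R) :
  (forall x, (0 <= f x)%E) -> measurable_fun setT f ->
  (\int[wm]_x f x = \int[mu]_x (f x * (h x)%:E))%E.
Proof.
move=> f0 mf.
(* The measure of density h is the mixture of the point masses h x delta_x. *)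
have fE x : (\int[mscale (NngNum (h0 x)) (dirac x)]_y f y = f x * (h x)%:E)%E.
  rewrite ge0_integral_mscale// integral_dirac// /dirac indicE in_setT mul1e.
  by rewrite muleC.
under [RHS]eq_integral do rewrite -fE.
apply: ge0_integral_mixture => // U mU.
  apply: emeasurable_funM; first exact/measurable_EFinP.
  exact: measurable_fun_dirac.
rewrite /= /weighted_measure integral_mkcond; apply: eq_integral => x _.
rewrite /mscale/= /dirac patchE indicE; case: (x \in U); by rewrite ?mule1 ?mule0.
Qed.

Lemma Rintegral_weighted (D : set T) (f : T -> R) : measurable D ->
  measurable_fun setT f ->
  \int[wm]_(x in D) f x = \int[mu]_(x in D) (f x * h x).
Proof.
move=> mD mf; rewrite Rintegral_mkcond [RHS]Rintegral_mkcond /Rintegral; congr fine.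
rewrite integralE [RHS]integralE.
have mfD : measurable_fun setT (EFin \o (f \_ D)).
  apply/measurable_EFinP/(@measurable_restrictT _ _ _ _ D) => //; exact: measurable_funTS.
rewrite !ge0_integral_weighted//; last 2 first.
  exact: measurable_funeneg.
  exact: measurable_funepos.
congr (_ - _)%E; apply: eq_integral => x _.
  rewrite !funeposE maxe_pMl ?lee_fin// mul0e -EFinM.
  by rewrite !patchE; case: ifPn => //; rewrite mul0r.
rewrite !funenegE maxe_pMl ?lee_fin// mul0e mulNe -EFinM.
by rewrite !patchE; case: ifPn => //; rewrite mul0r.
Qed.

End weighted_measure.

(** * The dual branching mechanism *)

Lemma measurable_origin (R : realType) (n : nat) :
  measurable ([set 0] : set (euclidean R n)).
Proof.
rewrite (_ : [set 0] = \bigcap_(j in [set: 'I_n])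
    ((fun y : euclidean R n => y j 0) @^-1` [set 0])).
  apply: fin_bigcap_measurable => // j _; rewrite -[X in measurable X]setTI.
  exact: measurable_coord.
apply/seteqP; split => y /=; first by move=> -> j _ /=; rewrite mxE.
by move=> y0; apply/matrixP => j k; rewrite mxE ord1; exact: y0.
Qed.

(** The mechanism vanishes at w, so psi(i, theta + w) is its increment from w. The
    increment of the compensated exponential is its value at theta weighted by
    exp(- [w, y]), plus theta_i y_i (1 - exp(- [w, y])); the latter and the cross
    term of the square are linear in theta_i and go to the diagonal of the drift
    matrix. *)
Lemma dual_branching_mechanism (R : realType) (ell : nat) (B : 'M[R]_ell)
    (beta : 'I_ell -> R)
    (Pi : 'I_ell -> {measure set (euclidean R ell) -> \bar R}) (w : 'cV[R]_ell) :
  branching_parameters B beta Pi -> orthant w ->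
  (forall i, mechanism B beta Pi i w = 0) ->
  branching_mechanism (dual_mechanism (mechanism B beta Pi) w).
Proof.
move=> bp w0 rootw.
pose h (y : euclidean R ell) : R := expR (- dotp w y).
have mh : measurable_fun setT h.
  by apply: measurableT_comp => //; apply: measurable_funN; exact: measurable_dotp.
have h0 y : 0 <= h y by exact: expR_ge0.
have h1 y : orthant y -> h y <= 1.
  by move=> y0; rewrite /h expR_le1 oppr_le0; exact: dotp_ge0.
pose Pi' i : {measure set (euclidean R ell) -> \bar R} := weighted_measure (Pi i) mh h0.
pose c i : R := \int[Pi i]_(y in @orthant R ell) (y i 0 * (1 - h y)).
pose B' : 'M[R]_ell := \matrix_(j, i) (B j i - (i == j)%:R * (2 * beta i * w i 0 + c i)).
have mO : measurable (@orthant R ell) by exact: measurable_orthant.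
have orthantD (t : 'cV[R]_ell) : orthant t -> orthant (t + w).
  by move=> t0 j; rewrite mxE addr_ge0.
have split_exp i (t y : 'cV[R]_ell) :
    compensated_exp i (t + w) y - compensated_exp i w y =
    compensated_exp i t y * h y + t i 0 * (y i 0 * (1 - h y)).
  rewrite /compensated_exp; have -> : dotp (t + w) y = dotp t y + dotp w y.
    by rewrite -big_split; apply: eq_bigr => j _; rewrite mxE mulrDl.
  rewrite /h opprD expRD !mxE; ring.
have int_tilted i (t : 'cV[R]_ell) : orthant t ->
    (Pi i).-integrable (@orthant R ell) (fun y => (compensated_exp i t y * h y)%:E).
  move=> t0; apply: le_integrable (integrable_compensated_exp bp i t0) => //.
    apply/measurable_EFinP; apply: measurable_funTS; apply: measurable_funM => //.
    exact: measurable_compensated_exp.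
  by move=> y y0; rewrite /= lee_fin normrM (ger0_norm (h0 y)) ler_piMr// h1.
have int_drift i :
    (Pi i).-integrable (@orthant R ell) (fun y => (y i 0 * (1 - h y))%:E).
  (* At theta = e_i the identity above expresses the integrand through compensated
     exponentials, whose integrability is known. *)
  pose e : 'cV[R]_ell := delta_mx i 0.
  have e0 : orthant e by move=> j; rewrite !mxE; case: (_ && _).
  have e1 : e i 0 = 1 by rewrite mxE !eqxx.
  have := integrableB mO (integrableB mO
    (integrable_compensated_exp bp i (orthantD _ e0))
    (integrable_compensated_exp bp i w0)) (int_tilted i _ e0).
  apply: eq_integrable => // y _ /=; rewrite -!EFinB split_exp e1 mul1r.
  by congr EFin; ring.
exists B', beta, Pi'; split.
  split.
  - move=> i j ij; rewrite mxE eq_sym (negbTE ij) mul0r subr0.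
    exact: (bp_offdiag bp).
  - exact: (bp_beta bp).
  - move=> i; rewrite /Pi' /= /weighted_measure.
    apply: null_set_integral; last exact: (bp_supp bp).
    + apply: measurableC; apply: measurableD => //; exact: measurable_origin.
    + apply/measurable_EFinP; exact: measurable_funTS.
  - move=> i.
    rewrite (eq_integral (fun y => (jump_weight i y)%:E))//.
    rewrite integral_mkcond ge0_integral_weighted//; last 2 first.
    + move=> y; rewrite patchE; case: ifPn => //; rewrite inE => y0.
      by rewrite lee_fin; exact: jump_weight_ge0.
    + apply/(@measurable_restrictT _ _ _ _ (@orthant R ell)) => //.
      apply/measurable_EFinP; apply: measurable_funTS; exact: measurable_jump_weight.
    apply: le_lt_trans (bp_int bp i).
    rewrite [leRHS]integral_mkcond; apply: ge0_le_integral => //.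
    + move=> y _; rewrite patchE; case: ifPn; rewrite ?mul0e//= inE => y0.
      by rewrite lee_fin mulr_ge0//; exact: jump_weight_ge0.
    + apply: emeasurable_funM; last exact/measurable_EFinP.
      apply/(@measurable_restrictT _ _ _ _ (@orthant R ell)) => //.
      apply/measurable_EFinP; apply: measurable_funTS; exact: measurable_jump_weight.
    + apply/(@measurable_restrictT _ _ _ _ (@orthant R ell)) => //.
      apply/measurable_EFinP; apply: measurable_funTS; exact: measurable_jump_weight.
    + move=> y _; rewrite !patchE; case: ifPn; rewrite ?mul0e//= inE => y0.
      by rewrite lee_fin ler_piMr ?h1//; exact: jump_weight_ge0.
move=> i t t0; rewrite /dual_mechanism.
rewrite -[LHS]subr0 -(rootw i).
have mechE C (Q : 'I_ell -> {measure set (euclidean R ell) -> \bar R}) s :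
    mechanism C beta Q i s = - dotp s (C *m delta_mx i 0) + beta i * s i 0 ^+ 2 +
      \int[Q i]_(y in @orthant R ell) compensated_exp i s y by [].
rewrite !mechE.
have drift_sum (A : 'M[R]_ell) (s : 'cV[R]_ell) :
    dotp s (A *m delta_mx i 0) = \sum_j s j 0 * A j i.
  by apply: eq_bigr => j _; rewrite -colE mxE.
have -> : \int[Pi i]_(y in @orthant R ell) compensated_exp i (t + w) y =
    \int[Pi' i]_(y in @orthant R ell) compensated_exp i t y + t i 0 * c i +
    \int[Pi i]_(y in @orthant R ell) compensated_exp i w y.
  apply/eqP; rewrite -subr_eq; apply/eqP.
  rewrite -RintegralB//; last 2 first.
    exact: (integrable_compensated_exp bp i (orthantD _ t0)).
    exact: (integrable_compensated_exp bp i w0).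
  rewrite Rintegral_weighted//; last exact: measurable_compensated_exp.
  rewrite -RintegralZl//.
  rewrite -RintegralD//; last 2 first.
    exact: (int_tilted _ _ t0).
    exact: (integrableZl mO _ (int_drift i)).
  by apply: eq_Rintegral => y _; rewrite split_exp.
rewrite !drift_sum.
have -> : \sum_j t j 0 * B' j i = \sum_j t j 0 * B j i -
    t i 0 * (2 * beta i * w i 0 + c i).
  rewrite [X in _ - X](_ : _ =
      \sum_j t j 0 * ((i == j)%:R * (2 * beta i * w i 0 + c i))).
    by rewrite -sumrB; apply: eq_bigr => j _; rewrite mxE; ring.
  rewrite (bigD1 i)//= eqxx mul1r big1 ?addr0// => j.
  by rewrite eq_sym => /negbTE ->; rewrite mul0r mulr0.
have -> : \sum_j (t + w) j 0 * B j i = \sum_j t j 0 * B j i + \sum_j w j 0 * B j i.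
  by rewrite -big_split; apply: eq_bigr => j _; rewrite mxE mulrDl.
by rewrite mxE; ring.
Qed.

(** * Bounded integrals and averages along a diffusion *)

Section bounded_integral.
Context d (T : measurableType d) (R : realType).
Implicit Types (g : T -> R).

Lemma bounded_integrable (mu : {measure set T -> \bar R}) (D : set T) g (C : R) :
  measurable D -> (mu D < +oo)%E -> measurable_fun D g ->
  (forall y, D y -> `|g y| <= C) -> mu.-integrable D (EFin \o g).
Proof.
move=> mD muD mg gC; apply: measurable_bounded_integrable => //.
exists C; split; first exact: num_real.
by move=> M CM y Dy /=; apply: le_trans (gC _ Dy) (ltW CM).
Qed.

Variables (P : {measure set T -> \bar R}) (P1 : P setT = 1%E).

Lemma Rintegral_prob_cst (r : R) : \int[P]_y r = r.
Proof. by rewrite Rintegral_cst// P1/= mulr1. Qed.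

Lemma bounded_integrable_prob g (C : R) : measurable_fun setT g ->
  (forall y, `|g y| <= C) -> P.-integrable setT (EFin \o g).
Proof.
move=> mg gC; apply: (@bounded_integrable _ _ _ C) => //.
by rewrite P1 ltry.
Qed.

Lemma Rintegral_prob_dist g (C c e : R) : measurable_fun setT g ->
  (forall y, `|g y| <= C) -> (forall y, `|g y - c| <= e) ->
  `|\int[P]_y g y - c| <= e.
Proof.
move=> mg gC gc; have ig := bounded_integrable_prob mg gC.
have ic (r : R) : P.-integrable setT (EFin \o (fun _ : T => r)).
  by apply: (@bounded_integrable_prob _ `|r|).
rewrite -{1}(Rintegral_prob_cst c) -RintegralB//.
rewrite -(Rintegral_prob_cst e); apply: normr_Rintegral_le => //.
exact: (integrableB measurableT ig (ic c)).
Qed.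

End bounded_integral.

Lemma measurable_cylinder (R : realType) (E : ptopologicalType)
    (Omega : pointedType) (X : R -> Omega -> borelType E) (t : R) :
  0 <= t -> measurable_fun setT (X t : process_space X -> borelType E).
Proof.
move=> t0 _ A mA; rewrite setTI; apply: sub_sigma_algebra.
by exists t => //; exists A.
Qed.

(** The transition kernels are measurable in the starting point for each fixed
    time. Measurability in time comes from path space: the average of h(s, .) is the
    expectation of h(s, xi_s), the map (s, o) |-> xi_s(o) is jointly measurable, and
    Tonelli's theorem applies. *)
Lemma measurable_diffusion_average (R : realType) (d : nat)
    (p : R -> R.-pker (euclidean R d) ~> (euclidean R d))
    (t C : R) (h : R * euclidean R d -> R) (x : euclidean R d) :
  conservative_diffusion p ->
  measurable_fun [set sy | 0 <= sy.1 <= t] h ->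
  (forall s y, 0 <= s <= t -> `|h (s, y)| <= C) ->
  measurable_fun `[0, t] (fun s => \int[p s x]_y h (s, y)).
Proof.
move=> [W [xi [Q [cxi _ pQ]]]].
set D := [set sy : R * euclidean R d | 0 <= sy.1 <= t]; move=> mh hC.
have mD : measurable D by exact: measurable_time_strip.
(* Adding C makes the integrand nonnegative, as Tonelli's theorem requires, and
   the positive part of the time makes it defined and measurable everywhere. *)
pose g := fun so : R * process_space xi => (h \_ D) (so.1, xi (Num.max so.1 0) so.2) + C.
have mhD : measurable_fun setT (h \_ D).
  exact/(@measurable_restrictT _ _ _ _ D).
have mxi : measurable_fun [set so : R * process_space xi | 0 <= so.1]
    (fun so => xi so.1 so.2).
  apply: measurable_process => //; first by move=> s s0; exact: measurable_cylinder.
have mpos := @measurable_nonneg_times R _ (process_space xi).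
have mmax : measurable_fun setT (fun so : R * process_space xi => Num.max so.1 0).
  by apply: measurable_maxr => //; exact: measurable_fst.
have mg : measurable_fun setT g.
  apply: measurable_funD => //; apply: (measurableT_comp mhD).
  apply: measurable_fun_pair; first exact: measurable_fst.
  have mpair : measurable_fun setT
      (fun so : R * process_space xi => (Num.max so.1 0, so.2)).
    by apply: measurable_fun_pair => //; exact: measurable_snd.
  apply: (measurable_comp mpos _ mxi mpair).
  by move=> _ [so _ <-] /=; rewrite le_max lexx orbT.
have [t0|t0] := leP 0 t; last first.
  rewrite (_ : [set` _] = set0); first exact: measurable_fun_set0.
  by apply/seteqP; split => s //=; rewrite in_itv/= => /andP[? ?]; lra.
have C0 : 0 <= C.
  by apply: le_trans (hC 0 0 _); rewrite ?lexx.
have hDC sy : `|(h \_ D) sy| <= C.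
  rewrite patchE; case: ifPn; last by rewrite normr0.
  by rewrite inE; case: sy => s y /= /hC.
have g0 so : 0 <= g so.
  by rewrite /g; have := hDC (so.1, xi (Num.max so.1 0) so.2);
    rewrite ler_norml => /andP[+ _]; rewrite lerNl -subr_ge0 opprK addrC.
have mF : measurable_fun setT (fun s => \int[Q x]_o g (s, o)).
  apply: measurableT_comp => //.
  apply: (@measurable_fun_fubini_tonelli_F _ _ _ _ _ (Q x) (EFin \o g)) => //.
  exact/measurable_EFinP.
apply: (eq_measurable_fun (fun s => \int[Q x]_o g (s, o) - C)); last first.
  by apply: measurable_funTS; exact: measurable_funB.
move=> s; rewrite inE/= in_itv/= => /andP[s0 st].
have mxs : measurable_fun setT (xi s : process_space xi -> euclidean R d).
  exact: measurable_cylinder.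
have mhs : measurable_fun setT (fun y => (h \_ D) (s, y)).
  exact: (measurableT_comp mhD).
have gE : \int[Q x]_o g (s, o) = \int[Q x]_o ((h \_ D) (s, xi s o)) + C.
  rewrite -[X in _ + X](Rintegral_prob_cst (probability_setT (Q x)) C) -RintegralD//.
  - by apply: eq_Rintegral => o _; rewrite /g/= (max_idPl s0).
  - apply: (@bounded_integrable_prob _ _ _ _ (probability_setT (Q x)) _ C) => //.
    exact: (measurableT_comp mhs).
  - by apply: (@bounded_integrable_prob _ _ _ _ (probability_setT (Q x)) _ C) => // _; rewrite ger0_norm.
rewrite gE addrK.
have -> : \int[p s x]_y h (s, y) = \int[p s x]_y (h \_ D) (s, y).
  by apply: eq_Rintegral => y _; rewrite patchE mem_set//; apply/andP; split.
rewrite /Rintegral; congr fine.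
rewrite (eq_measure_integral (pushforward (Q x) (xi s))); last first.
  by move=> A mA _; rewrite pQ.
rewrite integral_pushforward//.
  exact/measurable_EFinP.
apply: (@bounded_integrable_prob _ _ _ _ (probability_setT (Q x)) _ C) => //; exact: (measurableT_comp mhs).
Qed.

Lemma Rintegral_expR_le (R : realType) (a k t : R) : 0 < a -> 0 <= k -> 0 <= t ->
  \int[lebesgue_measure]_(s in `[0, t]) (k * expR (a * (t - s))) <=
  k / a * expR (a * t).
Proof.
move=> a0 k0; rewrite le_eqVlt => /predU1P[<-|t0].
  by rewrite set_itv1 Rintegral_set1 mulr_ge0 ?expR_ge0// divr_ge0// ltW.
pose F (s : R) := - (k / a) * expR (a * (t - s)).
have dF (x : R) : is_derive x 1 F (k * expR (a * (t - x))).
  have dl : is_derive x 1 (fun s : R => a * (t - s)) (- a).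
    by apply: is_derive_eq; rewrite /GRing.scale/=; ring.
  have de : is_derive x 1 (expR \o (fun s : R => a * (t - s)))
      (expR (a * (t - x)) * - a).
    by apply: is_derive1_comp.
  rewrite (_ : F = (- (k / a)) \*: (expR \o (fun s : R => a * (t - s)))).
    apply: is_derive_eq.
    by rewrite /GRing.scale/=; field; rewrite gt_eqF.
  by [].
have cF : continuous F.
  move=> x; apply/differentiable_continuous/derivable1_diffP.
  by have [] := dF x.
have cf : continuous (fun s : R => k * expR (a * (t - s))).
  move=> x; apply: cvgM; first exact: cvg_cst.
  apply: (@continuous_comp _ _ _ (fun s : R => a * (t - s)) expR); last exact: continuous_expR.
  by apply: cvgM; [exact: cvg_cst|apply: cvgB; [exact: cvg_cst|exact: cvg_id]].
rewrite /Rintegral (@continuous_FTC2 _ _ F)//.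
- rewrite /F subrr mulr0 expR0 subr0/=.
  have : 0 <= k / a by rewrite divr_ge0// ltW.
  by move: (k / a) (expR _) => q e q0; lra.
- exact: continuous_subspaceT.
- split; [by move=> x _; have [] := dF x| |].
  + by apply: cvg_at_right_filter; exact: cF.
  + by apply: cvg_at_left_filter; exact: cF.
- by move=> x _; rewrite derive1E; exact: (@derive_val _ _ _ _ _ _ _ (dF x)).
Qed.

Lemma Rintegral_lebesgue_bounded_integrable (R : realType) (t C : R) (g : R -> R) :
  measurable_fun `[0, t] g -> (forall s, 0 <= s <= t -> `|g s| <= C) ->
  lebesgue_measure.-integrable `[0, t] (EFin \o g).
Proof.
move=> mg gC.
have fin : (lebesgue_measure (`[0%R, t]%classic : set R) < +oo)%E.
  by rewrite lebesgue_measure_itv/=; case: ifP => _; rewrite ?ltry.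
apply: (@bounded_integrable _ _ _ _ _ _ C) => //.
Qed.

(** * Spatially constant cumulants *)

Section spatial_independence.
Variables (R : realType) (d ell : nat).
Variable P : 'I_ell -> R -> R.-pker (euclidean R d) ~> (euclidean R d).
Variables (B : 'M[R]_ell) (beta : 'I_ell -> R).
Variable Pi : 'I_ell -> {measure set (euclidean R ell) -> \bar R}.
Hypothesis bp : branching_parameters B beta Pi.
Hypothesis diffP : forall i, conservative_diffusion (P i).
Local Notation psi := (mechanism B beta Pi).

(** With constant data the linear term does not depend on the starting point,
    because the kernels are probabilities. In the integral term, the average of
    psi(v(t - s)) under any starting point differs from its value at one fixed
    point z by at most L times the oscillation of v(t - s). A Gronwall argument
    then forces the oscillation to vanish. *)
Lemma cumulant_solution_spatially_constant (c : 'I_ell -> R)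
    (v : R -> 'I_ell -> euclidean R d -> R) :
  cumulant_solution P psi (fun i _ => c i) v ->
  forall t i x x', 0 <= t -> v t i x = v t i x'.
Proof.
move=> sol T i0 z z' T0.
have [|C vC] := cs_locally_bounded sol (T := T + 1); first by rewrite ltr_wpDl.
pose K := Num.max C 0.
have K0 : 0 <= K by rewrite le_max lexx orbT.
have vK (t : R) i x : 0 <= t <= T -> 0 <= v t i x <= K.
  move=> /andP[t0 tT]; rewrite (cs_nonneg sol)//=.
  rewrite le_max (le_trans (ler_norm _))//; apply: vC.
  by rewrite t0/= (le_trans tT)// lerDl.
have [L L0 psiL] := mechanism_lipschitz bp K0.
pose H := L * K + \sum_i `|psi i 0|.
pose a := 4 * L + 1.
have a0 : 0 < a by rewrite ltr_wpDl// mulr_ge0.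
pose h t i (sy : R * euclidean R d) := psi i (\col_j v (t - sy.1) j sy.2).
have colK (r : R) (j : 'I_ell) (y : euclidean R d) : 0 <= r <= T ->
    0 <= (\col_k v r k y) j (0 : 'I_1) <= K.
  by move=> tT; rewrite mxE vK.
have hH (t : R) i (s : R) y : 0 <= s <= t -> t <= T -> `|h t i (s, y)| <= H.
  move=> /andP[s0 st] tT.
  have tsT : 0 <= t - s <= T by apply/andP; split; lra.
  rewrite -[h _ _ _](subrK (psi i 0)); apply: le_trans (ler_normD _ _) (lerD _ _).
    apply: psiL; rewrite /h/=.
    - by move=> j; have /andP[] := colK _ j y tsT.
    - by move=> j; rewrite mxE.
    - by move=> j; have /andP[] := colK _ j y tsT.
    - by move=> j; rewrite mxE.
    - move=> j; have /andP[? ?] := vK _ j y tsT.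
      by rewrite !mxE subr0 ger0_norm.
  by rewrite (bigD1 i)//= lerDl sumr_ge0.
have mh (t : R) i : measurable_fun [set sy : R * euclidean R d | 0 <= sy.1 <= t] (h t i).
  apply: (measurable_mechanism_comp bp); first exact: measurable_time_strip.
    move=> j.
    rewrite (_ : (fun _ => _) = (fun tx => v tx.1 j tx.2) \o
        (fun sy : R * euclidean R d => (t - sy.1, sy.2))); last first.
      by apply/funext => sy /=; rewrite mxE.
    apply: (measurable_comp _ _ (cs_measurable sol j)).
    - exact: measurable_nonneg_times.
    - by move=> _ [sy /andP[? ?] <-] /=; rewrite subr_ge0.
    - apply: measurable_funTS; apply: measurable_fun_pair; last exact: measurable_snd.
      by apply: measurable_funB => //; exact: measurable_fst.
  move=> [s y] /= /andP[s0 st] j; rewrite mxE (cs_nonneg sol)// subr_ge0//.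
have mhs (t : R) i (s : R) : 0 <= s <= t -> measurable_fun setT (fun y => h t i (s, y)).
  move=> st.
  apply: (measurable_comp _ _ (mh t i)).
  - exact: measurable_time_strip.
  - by move=> _ [y _ <-].
  - by apply: measurable_fun_pair.
pose A t i x s := \int[P i s x]_y h t i (s, y).
have AH (t : R) i x (s : R) : 0 <= s <= t -> t <= T -> `|A t i x s| <= H.
  move=> st tT; rewrite -[A _ _ _ _]subr0.
  apply: (Rintegral_prob_dist (prob_kernel _) (C := H)); first exact: mhs.
    by move=> y; exact: hH.
  by move=> y; rewrite subr0; exact: hH.
have iA (t : R) i x : t <= T -> lebesgue_measure.-integrable `[0, t] (EFin \o A t i x).
  move=> tT; apply: (@Rintegral_lebesgue_bounded_integrable _ _ H).
    by apply: (@measurable_diffusion_average _ _ _ _ H) => // s y st; exact: hH.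
  by move=> s st; exact: AH.
(* An oscillation bound M e^(at) feeds back through the equation and improves
   to half of itself, since the integral of e^(a(t-s)) gains a factor 1/a. *)
have contract (M : R) : 0 <= M ->
    (forall t i x x', 0 <= t <= T -> `|v t i x - v t i x'| <= M * expR (a * t)) ->
    forall t i x x', 0 <= t <= T -> `|v t i x - v t i x'| <= M / 2 * expR (a * t).
  move=> M0 osc t i x x' /andP[t0 tT].
  have vE x1 : v t i x1 = c i - \int[lebesgue_measure]_(s in `[0, t]) A t i x1 s.
    by rewrite (cs_equation sol)// (Rintegral_prob_cst (prob_kernel _)).
  rewrite !vE opprD opprK addrACA subrr add0r addrC.
  rewrite -RintegralB//; last 2 first.
  - exact: (iA _ _ _ tT).
  - exact: (iA _ _ _ tT).
  have close (s : R) x1 : 0 <= s <= t -> `|A t i x1 s - h t i (s, z)| <= L * (M * expR (a * (t - s))).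
    move=> /andP[s0 st].
    have tsT : 0 <= t - s <= T by apply/andP; split; lra.
    apply: (Rintegral_prob_dist (prob_kernel _) (C := H)).
    - by apply: mhs; rewrite s0.
    - by move=> y; apply: hH => //; rewrite s0.
    - move=> y; apply: psiL => j; rewrite /= ?mxE.
      + by have /andP[] := vK _ j y tsT.
      + by have /andP[] := vK _ j z tsT.
      + by have /andP[] := vK _ j y tsT.
      + by have /andP[] := vK _ j z tsT.
      + exact: osc.
  apply: (@le_trans _ _ (\int[lebesgue_measure]_(s in `[0, t])
      (2 * L * M * expR (a * (t - s))))).
    apply: normr_Rintegral_le => //.
    - exact: (integrableB _ (iA _ _ _ tT) (iA _ _ _ tT)).
    - apply: (@Rintegral_lebesgue_bounded_integrable _ _ (2 * L * M * expR (a * t))).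
        apply: measurable_funTS; apply: measurable_funM => //.
        apply: measurableT_comp => //; apply: measurable_funM => //.
        exact: measurable_funB.
      move=> s /andP[s0 st]; rewrite ger0_norm; last by rewrite !mulr_ge0 ?expR_ge0.
      by rewrite ler_wpM2l ?mulr_ge0// ler_expR ler_pM2l// gerBl.
    - move=> s /=; rewrite in_itv/= => st.
      rewrite -[X in X - _](subrK (h t i (s, z))) -addrA.
      apply: le_trans (ler_normD _ _) _.
      rewrite (distrC (h t i (s, z))).
      have := close s x st; have := close s x' st.
      set q := M * expR _; move=> ? ?; rewrite -(mulrA (2 * L)) -/q.
      by apply: le_trans (lerD _ _) _; [eassumption|eassumption|lra].
  apply: le_trans (Rintegral_expR_le a0 _ t0) _; first by rewrite !mulr_ge0.
  rewrite ler_wpM2r ?expR_ge0// ler_pdivrMr// /a; nra.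
have osc n (t : R) i x x' : 0 <= t <= T ->
    `|v t i x - v t i x'| <= 2 * K * 2^-1 ^+ n * expR (a * t).
  elim: n t i x x' => [|n IH] t i x x' tT.
    have /andP[? ?] := vK t i x tT; have /andP[? ?] := vK t i x' tT.
    have e1 : 1 <= expR (a * t).
      by rewrite -[leLHS]expR0 ler_expR; apply: mulr_ge0; [exact: ltW|case/andP: tT].
    have := ler_peMr K0 e1; rewrite expr0 ler_norml => ?; apply/andP; split; lra.
  rewrite exprSr mulrA; apply: contract => //.
  by rewrite !mulr_ge0// exprn_ge0// invr_ge0.
apply/eqP; rewrite -subr_eq0 -normr_le0.
have cv : 2 * K * 2^-1 ^+ n * expR (a * T) @[n --> \oo] --> (2 * K * 0 * expR (a * T) : R).
  apply: cvgM; last exact: cvg_cst.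
  apply: cvgM; first exact: cvg_cst.
  by apply: cvg_expr; rewrite ger0_norm ?invr_ge0// invf_lt1// ltr1n.
rewrite mulr0 mul0r in cv.
rewrite -(cvg_lim _ cv)//; apply: limr_ge; first by apply/cvg_ex; eexists; exact: cv.
by near=> n; apply: osc; rewrite T0/=.
Unshelve. all: by end_near.
Qed.

End spatial_independence.

(** * Configurations and their pairings *)

Section distance_cutoff.
Variables (R : realType) (V : normedModType R) (U : set V).

(** These cutoffs increase to the indicator of the open set U; being continuous and
    bounded, they are test functions of the weak topology. *)
Definition distance_out (x : V) : R := inf [set `|x - y| | y in ~` U].

Definition open_cutoff (n : nat) (x : V) : R := Num.min 1 (n%:R * distance_out x).

Hypothesis U_neqT : ~` U !=set0.

Let has_lb x : has_lbound [set `|x - y| | y in ~` U].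
Proof. by exists 0 => _ [y _ <-]. Qed.

Let nonempty x : [set `|x - y| | y in ~` U] !=set0.
Proof. by have [y Uy] := U_neqT; exists `|x - y|, y. Qed.

Lemma distance_out_ge0 x : 0 <= distance_out x.
Proof. by apply: lb_le_inf => // _ [y _ <-]. Qed.

Lemma distance_out_lipschitz x x' : distance_out x - distance_out x' <= `|x - x'|.
Proof.
rewrite lerBlDr -lerBlDl; apply: lb_le_inf => // _ [y Uy <-].
rewrite lerBlDl; apply: le_trans (ler_distD x' x y).
by apply: ge_inf => //; exists y.
Qed.

Lemma distance_out_continuous : continuous distance_out.
Proof.
move=> x; apply/cvgrPdist_lt => e e0.
near=> y; rewrite ltr_norml; apply/andP; split.
  rewrite ltrNl opprB; apply: le_lt_trans (distance_out_lipschitz _ _) _.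
  by rewrite distrC; near: y; apply: cvgr_dist_lt.
apply: le_lt_trans (distance_out_lipschitz _ _) _.
by near: y; apply: cvgr_dist_lt.
Unshelve. all: by end_near.
Qed.

Lemma open_cutoff_continuous n : continuous (open_cutoff n).
Proof.
move=> x; apply: (@continuous_min _ _ (fun=> 1) (fun x => n%:R * distance_out x)).
  exact: cst_continuous.
by apply: cvgM; [exact: cvg_cst|exact: distance_out_continuous].
Qed.

Lemma open_cutoff_ge0 n x : 0 <= open_cutoff n x.
Proof. by rewrite le_min ler01 mulr_ge0// distance_out_ge0. Qed.

Lemma open_cutoff_le1 n x : open_cutoff n x <= 1.
Proof. by rewrite ge_min lexx. Qed.

Lemma open_cutoff_nondecreasing x : nondecreasing_seq (open_cutoff ^~ x).
Proof.
move=> m n mn; rewrite le_min !ge_min lexx/= ler_wpM2r ?orbT ?ler_nat//.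
exact: distance_out_ge0.
Qed.

Lemma open_cutoff_cvg x : open U -> open_cutoff n x @[n --> \oo] --> (\1_U x : R).
Proof.
move=> oU; have [Ux|nUx] := pselect (U x); last first.
  have d0 : distance_out x = 0.
    apply/eqP; rewrite eq_le distance_out_ge0 andbT.
    by apply: ge_inf => //; exists x => //; rewrite subrr normr0.
  rewrite indicE memNset// (_ : (fun n => _) = cst 0); first exact: cvg_cst.
  by apply/funext => n; rewrite /open_cutoff d0 mulr0 (min_idPr _).
have /nbhs_ballP[e /= e0 xeU] : nbhs x U by exact: open_nbhs_nbhs.
have de : e <= distance_out x.
  apply: lb_le_inf => // _ [y Uy <-]; rewrite leNgt; apply/negP => xy.
  by apply: Uy; apply: xeU; rewrite -ball_normE.
rewrite indicE mem_set//; apply: cvg_near_cst.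
near=> n; rewrite /open_cutoff; apply/min_idPl.
apply: (@le_trans _ _ (n%:R * e)); last by rewrite ler_wpM2l.
rewrite -ler_pdivrMr// mul1r; near: n; exact: nbhs_infty_ger.
Unshelve. all: by end_near.
Qed.

End distance_cutoff.

Lemma continuous_sumr (R : realType) (T : topologicalType) (n : nat)
    (F : 'I_n -> T -> R) :
  (forall i, continuous (F i)) -> continuous (fun x => \sum_(i < n) F i x).
Proof.
move=> cF x; suff cS (s : seq 'I_n) :
    \sum_(i <- s) F i y @[y --> x] --> \sum_(i <- s) F i x by exact: cS.
elim: s => [|i s IH].
  rewrite big_nil (_ : (fun y => _) = (fun=> 0)); first exact: cvg_cst.
  by apply/funext => y; rewrite big_nil.
rewrite big_cons (_ : (fun y => _) = (fun y => F i y + \sum_(j <- s) F j y)).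
  by apply: cvgD => //; exact: cF.
by apply/funext => y; rewrite big_cons.
Qed.

Section configurations.
Variables (R : realType) (d ell : nat).
Local Notation space := (euclidean R d).
Local Notation conf := (configurations R d ell).

Lemma continuous_integrate i (g : space -> R) : bounded_continuous g ->
  continuous (fun mu : measure_vectors R d ell => \int[mu i]_x g x).
Proof.
move=> bg mu.
have c1 : {for mu, continuous (fun m : measure_vectors R d ell => m i)}.
  exact: (@proj_continuous _ (fun _ : 'I_ell => finite_measures R d) i mu).
have c2 : continuous (@integrate_bounded_continuous R d).
  exact: initial_continuous.
have c3 := @proj_continuous {classic {g : space -> R | bounded_continuous g}} (fun=> R)
  (exist _ g bg).
exact: (continuous_comp (continuous_comp c1 (c2 _)) (c3 _)).
Qed.

Lemma measurable_integrate_continuous i (g : space -> R) : bounded_continuous g ->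
  measurable_fun setT (fun mu : conf => \int[mu i]_x g x).
Proof.
move=> bg.
apply: (@continuous_borel_measurable R (measure_vectors R d ell)
  (fun mu : measure_vectors R d ell => \int[mu i]_x g x)).
exact: continuous_integrate.
Qed.

Lemma bounded_continuous_one : bounded_continuous (fun _ : space => 1 : R).
Proof. by split; [exact: cst_continuous|exists 1 => _; rewrite normr1]. Qed.

Lemma continuous_total_mass :
  continuous (@total_mass R d ell : measure_vectors R d ell -> R).
Proof.
apply: (@continuous_sumr R _ ell (fun i (mu : measure_vectors R d ell) => \int[mu i]_x 1)).
by move=> i; exact: (continuous_integrate bounded_continuous_one).
Qed.

(** Open sets are reached through the cutoffs, whose integrals are continuous for
    the weak topology; all Borel sets follow by Dynkin's theorem, the total mass
    being finite. *)
Lemma measurable_coordinate_mass i (A : set space) : measurable A ->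
  measurable_fun setT (fun mu : conf => mu i A).
Proof.
move=> mA.
have mT : measurable_fun setT (fun mu : conf => mu i setT).
  rewrite (_ : (fun mu : conf => _) = EFin \o (fun mu : conf => \int[mu i]_x 1)).
    by apply/measurable_EFinP; exact: (measurable_integrate_continuous _ bounded_continuous_one).
  apply/funext => mu /=; rewrite Rintegral_cst// mul1r fineK//.
  exact: fin_num_measure.
pose Q (B : set space) := measurable_fun setT (fun mu : conf => mu i B).
apply: (@dynkin_induction _ space (@open 'cV[R]_d) Q) => //.
- by move=> U W; exact: openI.
- move=> U oU; have [nU|U0] := pselect (~` U !=set0); last first.
    suff -> : U = setT by exact: mT.
    by apply/seteqP; split => // x _; apply: contrapT => Ux; apply: U0; exists x.
  have mg n : measurable_fun setT (open_cutoff U n : space -> R).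
    apply: (@continuous_borel_measurable R 'cV[R]_d); exact: open_cutoff_continuous.
  have ig n (mu : conf) : (mu i).-integrable setT (EFin \o (open_cutoff U n : space -> R)).
    apply: (@bounded_integrable _ _ _ _ _ _ 1) => //.
      by rewrite ltey_eq fin_num_measure.
    by move=> x _; rewrite ger0_norm ?open_cutoff_le1// open_cutoff_ge0.
  apply: (@emeasurable_fun_cvg _ _ _ _ (fun n (mu : conf) =>
      (\int[mu i]_x open_cutoff U n x)%:E)).
    move=> n; apply/measurable_EFinP; apply: measurable_integrate_continuous.
    split; first exact: open_cutoff_continuous.
    by exists 1 => x; rewrite ger0_norm ?open_cutoff_le1// open_cutoff_ge0.
  move=> mu _; have mU : measurable (U : set space) by exact: sub_sigma_algebra.
  rewrite -[in X in _ --> X](setIT U) -integral_indic// (_ : (fun n => _) =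
      (fun n => \int[mu i]_x (open_cutoff U n x)%:E)%E); last first.
    by apply/funext => n; rewrite /Rintegral fineK//; exact: (integrable_fin_num measurableT (ig n mu)).
  rewrite (_ : (\int[_]_x _)%E = (\int[mu i]_x lim ((open_cutoff U n x)%:E @[n --> \oo]))%E).
    apply: cvg_monotone_convergence => //.
    - by move=> n; exact/measurable_EFinP.
    - by move=> n x _; rewrite lee_fin open_cutoff_ge0.
    - by move=> x _ m n mn; rewrite lee_fin; exact: open_cutoff_nondecreasing.
  apply: eq_integral => x _; apply/esym/cvg_lim => //.
  by apply/cvg_EFin; [exact: nearW|exact: open_cutoff_cvg].
- move=> S mS QS; rewrite /Q.
  rewrite (_ : (fun mu : conf => _) = (fun mu : conf => mu i setT - mu i S)%E).
    exact: emeasurable_funB.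
  apply/funext => mu; rewrite -setTD measureD// ?setTI//.
  by rewrite ltey_eq fin_num_measure.
- move=> F mF tF QF; rewrite /Q.
  rewrite (_ : (fun mu : conf => _) = (fun mu : conf =>
      \big[+%E/0%E]_(0 <= k <oo) mu i (F k))).
    by apply: ge0_emeasurable_sum => // k _; exact: QF.
  apply/funext => mu; rewrite measure_semi_bigcup//; exact: bigcupT_measurable.
Qed.

Lemma measurable_pairing (f : 'I_ell -> space -> R) : bounded_borel_nonneg f ->
  measurable_fun setT (pairing f : conf -> R).
Proof.
move=> bf; apply: measurable_sum => i; have [mf f0 _] := bf i.
apply: measurableT_comp => //.
apply: (@measurable_fun_integral_kernel _ _ conf space R (fun mu => mu i)).
- by move=> U mU; exact: measurable_coordinate_mass.
- by move=> x; rewrite lee_fin.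
- exact/measurable_EFinP.
Qed.

Lemma bounded_borel_integrable (mu : finite_measures R d) (g : space -> R) :
  measurable_fun setT g -> (exists C, forall x, `|g x| <= C) ->
  mu.-integrable setT (EFin \o g).
Proof.
move=> mg [C gC]; apply: (@bounded_integrable _ _ _ _ _ _ C) => //.
by rewrite ltey_eq fin_num_measure.
Qed.

Lemma pairing_ge0 (f : 'I_ell -> space -> R) (mu : conf) :
  (forall i x, 0 <= f i x) -> 0 <= pairing f mu.
Proof. by move=> f0; apply: sumr_ge0 => i _; apply: Rintegral_ge0. Qed.

Lemma pairingD (f g : 'I_ell -> space -> R) (mu : conf) :
  bounded_borel_nonneg f -> bounded_borel_nonneg g ->
  pairing (fun i x => f i x + g i x) mu = pairing f mu + pairing g mu.
Proof.
have bi h i : bounded_borel_nonneg h -> (mu i).-integrable setT (EFin \o h i).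
  move=> /(_ i)[mh h0 [C hC]]; apply: bounded_borel_integrable => //.
  by exists C => x; rewrite ger0_norm.
move=> bf bg; rewrite -big_split; apply: eq_bigr => i _ /=.
by rewrite RintegralD//; exact: bi.
Qed.

Lemma pairing_cst (c : 'I_ell -> R) (mu : conf) :
  pairing (fun i _ => c i) mu = \sum_i c i * fine (mu i setT).
Proof. by apply: eq_bigr => i _; rewrite Rintegral_cst. Qed.

Lemma bounded_borel_cst (c : 'I_ell -> R) : (forall i, 0 <= c i) ->
  bounded_borel_nonneg (fun i (_ : space) => c i).
Proof. by move=> c0 i; split => //; exists (c i). Qed.

Lemma pairing_point_mass (f : 'I_ell -> space -> R) i x :
  measurable_fun setT (f i) -> pairing f (point_mass i x : conf) = f i x.
Proof.
move=> mf; rewrite /pairing (bigD1 i)//= big1 ?addr0.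
  rewrite /point_mass eqxx /Rintegral integral_dirac//; last exact/measurable_EFinP.
  by rewrite diracT mul1e.
move=> j ji; rewrite /point_mass (negbTE ji) /Rintegral.
by rewrite integral_measure_zero.
Qed.

Lemma bounded_borel_one : bounded_borel_nonneg (fun (_ : 'I_ell) (_ : space) => 1 : R).
Proof. exact: bounded_borel_cst. Qed.

Lemma measurable_total_mass : measurable_fun setT (@total_mass R d ell : conf -> R).
Proof. exact: measurable_pairing bounded_borel_one. Qed.

Lemma total_mass_ge0 (mu : conf) : 0 <= total_mass mu.
Proof. exact: pairing_ge0. Qed.

Lemma total_massE (mu : conf) : total_mass mu = \sum_i fine (mu i setT).
Proof. by rewrite /total_mass pairing_cst; apply: eq_bigr => i _; rewrite mul1r. Qed.

End configurations.

(** * The strong Markov property at stopping times *)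

(** The measurability proof is an argument, which names the measure structure of
    the pushforward explicitly: functions such as the position at a stopping time
    have none that could be inferred. *)
Definition image_measure d1 d2 (T1 : measurableType d1) (T2 : measurableType d2)
    (R : realType) (m : {measure set T1 -> \bar R}) (f : T1 -> T2)
    (mf : measurable_fun setT f) : {measure set T2 -> \bar R} :=
  measure_function_pushforward__canonical__measure_function_Measure m mf.

Section strong_markov_theory.
Variables (R : realType) (E : ptopologicalType) (Omega : pointedType).
Variable X : R -> Omega -> borelType E.
Variable Pr : borelType E -> probability (process_space X) R.
Hypothesis sm : strong_markov Pr.
Implicit Types (T : Omega -> \bar R) (G : set (process_space X)).

(** Makes the closure properties of measurable sets available for the histories,
    which are sigma-algebras on the same space of paths as the ambient one. *)
Lemma historyE t G : history X t G =
  measurable (G : set (g_sigma_algebraType (cylinders X `[0, t]))).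
Proof. by []. Qed.

Lemma history_cylinder s t A : 0 <= s <= t -> measurable A ->
  history X t (X s @^-1` A).
Proof.
move=> st mA; apply: sub_sigma_algebra; exists s; first by rewrite /= in_itv.
by exists A.
Qed.

Lemma history_measurable t G : history X t G -> measurable G.
Proof.
apply: smallest_sub; first exact: smallest_sigma_algebra.
move=> _ [s + [A mA <-]]; rewrite /= in_itv/= => /andP[s0 _].
by apply: sub_sigma_algebra; exists s => //; exists A.
Qed.

Lemma history_le s t : s <= t -> history X s `<=` history X t.
Proof.
move=> st; apply: smallest_sub; first exact: smallest_sigma_algebra.
move=> _ [r + [A mA <-]]; rewrite /= in_itv/= => /andP[r0 rs].
by apply: history_cylinder => //; rewrite r0 (le_trans rs).
Qed.

Lemma history0 t : history X t set0.
Proof. by rewrite historyE. Qed.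

Lemma historyT t : history X t setT.
Proof. by rewrite historyE. Qed.

Lemma stopping_time_cst s : 0 <= s -> stopping_time X (fun _ => s%:E).
Proof.
move=> s0; split => // t t0; have [st|st] := leP s t.
  rewrite (_ : [set _ | _] = setT); first exact: historyT.
  by apply/seteqP; split => // o _; rewrite /= lee_fin.
rewrite (_ : [set _ | _] = set0); first exact: history0.
by apply/seteqP; split => // o /=; rewrite lee_fin leNgt st.
Qed.

Lemma stopped_history_cst s G : 0 <= s -> history X s G ->
  stopped_history (X := X) (fun _ => s%:E) G.
Proof.
move=> s0 hG; split; first exact: history_measurable hG.
move=> t t0; have [st|st] := leP s t.
  rewrite (_ : _ `&` _ = G); first exact: history_le hG.
  by apply/seteqP; split => [w []//|w Gw]; split => //=; rewrite lee_fin.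
rewrite (_ : _ `&` _ = set0); first exact: history0.
by apply/seteqP; split => // o [_ /=]; rewrite lee_fin leNgt st.
Qed.

Lemma stopped_historyT T : stopping_time X T -> stopped_history (X := X) T setT.
Proof. by move=> [T0 hT]; split => // t t0; rewrite setTI; exact: hT. Qed.

Lemma stopped_historyI T G G' :
  stopped_history (X := X) T G -> stopped_history (X := X) T G' ->
  stopped_history (X := X) T (G `&` G').
Proof.
move=> [mG hG] [mG' hG']; split; first exact: measurableI.
move=> t t0; rewrite setIIl historyE.
by apply: measurableI; [exact: hG|exact: hG'].
Qed.

Lemma stopping_timeD T s : 0 <= s -> stopping_time X T ->
  stopping_time X (fun o => (T o + s%:E)%E).
Proof.
move=> s0 [T0 hT]; split; first by move=> o; rewrite adde_ge0.
move=> t t0; have [st|st] := leP s t.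
  rewrite (_ : [set _ | _] = [set o | (T o <= (t - s)%:E)%E]).
    by apply: (@history_le (t - s)); [rewrite gerBl|apply: hT; rewrite subr_ge0].
  by apply/seteqP; split => o /=; rewrite EFinB leeBrDr.
rewrite (_ : [set _ | _] = set0); first exact: history0.
apply/seteqP; split => // o /=; apply/negP; rewrite -ltNge.
by apply: (@lt_le_trans _ _ s%:E); rewrite ?lte_fin// leeDr.
Qed.

Lemma stopped_historyD T s G : 0 <= s -> stopping_time X T ->
  stopped_history (X := X) T G ->
  stopped_history (X := X) (fun o => (T o + s%:E)%E) G.
Proof.
move=> s0 [T0 _] [mG hG]; split => // t t0; have [st|st] := leP s t.
  rewrite (_ : [set _ | _] = [set o | (T o <= (t - s)%:E)%E]).
    by apply: (@history_le (t - s)); [rewrite gerBl|apply: hG; rewrite subr_ge0].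
  by apply/seteqP; split => o /=; rewrite EFinB leeBrDr.
rewrite (_ : _ `&` _ = set0); first exact: history0.
apply/seteqP; split => // o [_ /=]; apply/negP; rewrite -ltNge.
by apply: (@lt_le_trans _ _ s%:E); rewrite ?lte_fin// leeDr.
Qed.

Lemma finite_time_measurable T : stopping_time X T ->
  stopped_history (X := X) T [set o | (T o < +oo)%E].
Proof.
move=> sT; have := sm_stopped sm sT measurableT.
by rewrite (_ : [set o | _ /\ _] = [set o | (T o < +oo)%E])//; apply/seteqP; split => o /=; tauto.
Qed.

Lemma stopped_position T s A : 0 <= s -> stopping_time X T -> measurable A ->
  stopped_history (X := X) (fun o => (T o + s%:E)%E)
    [set o | (T o < +oo)%E /\ A (X (fine (T o) + s) o)].
Proof.
move=> s0 sT mA; have := sm_stopped sm (stopping_timeD s0 sT) mA.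
congr stopped_history; apply/seteqP; split => o /=.
  by case: (T o) (sT.1 o) => [r| |]//= _ []; [rewrite !ltry|rewrite ltxx].
by case: (T o) (sT.1 o) => [r| |]//= _ []; [rewrite !ltry|rewrite ltxx].
Qed.

Section stopped.
Variables (T : Omega -> \bar R) (sT : stopping_time X T).
Variables (G : set (process_space X)) (hG : stopped_history (X := X) T G).

Let D : set (process_space X) := G `&` [set o | (T o < +oo)%E].

Let mD : measurable D.
Proof. by apply: measurableI; [exact: hG.1|exact: (finite_time_measurable sT).1]. Qed.

(** The position at T + s, moved to a fixed point off D: where T is infinite the
    expression X (fine (T o) + s) o is meaningless and need not be measurable. *)
Let Y s (o : process_space X) : borelType E :=
  if o \in D then X (fine (T o) + s) o else point.

Let mY s : 0 <= s -> measurable_fun setT (Y s).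
Proof.
move=> s0 _ A mA; rewrite setTI.
rewrite (_ : _ @^-1` _ = (D `&` [set o | (T o < +oo)%E /\ A (X (fine (T o) + s) o)]) `|`
   ((~` D) `&` (if point \in A then setT else set0))).
  apply: measurableU; first by apply: measurableI => //; exact: (stopped_position s0 sT mA).1.
  by apply: measurableI; [exact: measurableC|case: ifPn].
apply/seteqP; split => o; rewrite /= /Y.
  have [Do|Do] := boolP (o \in D).
    by move=> Ao; left; rewrite inE in Do; split => //; split => //; case: Do.
  move=> Ap; right; split; first by move/mem_set; apply/negP.
  by rewrite mem_set.
move=> [[Do [_ Ao]]|[nDo +]]; first by rewrite mem_set.
by rewrite (memNset nDo); case: ifPn => //; rewrite inE.
Qed.

Lemma stopped_position_extension s : 0 <= s ->
  exists2 Z : process_space X -> borelType E, measurable_fun setT Z &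
    forall o, D o -> Z o = X (fine (T o) + s) o.
Proof.
by move=> s0; exists (Y s); [exact: mY|move=> o Do; rewrite /Y mem_set].
Qed.

(** The strong Markov property for indicators says that, on D, the law of the
    position at T + s is a mixture of the laws at time s from X_T; integrals
    against a mixture are iterated integrals. *)
Lemma strong_markov_integral s (h : borelType E -> \bar R) x :
  0 <= s -> (forall y, (0 <= h y)%E) -> measurable_fun setT h ->
  (\int[Pr x]_(o in D) h (X (fine (T o) + s) o) =
   \int[Pr x]_(o in D) \int[Pr (X (fine (T o)) o)]_o' h (X s o'))%E.
Proof.
move=> s0 h0 mh.
have mXs : measurable_fun setT (X s : process_space X -> borelType E).
  exact: measurable_cylinder.
have m1 : measurable_fun setT (\1_D : process_space X -> R) by exact: measurable_indic.
have p1 o : 0 <= (\1_D o : R) by rewrite indicE.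
pose nu : {measure set (borelType E) -> \bar R} :=
  image_measure (weighted_measure (Pr x) m1 p1) (mY s0).
pose K (o : process_space X) : {measure set (borelType E) -> \bar R} :=
  mscale (NngNum (p1 o)) (image_measure (Pr (Y 0 o)) mXs).
have KE o U : K o U = ((\1_D o)%:E * Pr (Y 0 o) (X s @^-1` U))%E by [].
have mX0 : measurable_fun setT (Y 0) by exact: mY.
have Y0E (o : process_space X) : D o -> Y 0 o = X (fine (T o)) o.
  by move=> Do; rewrite /Y mem_set// addr0.
have mK U : measurable U -> measurable_fun setT (K ^~ U).
  move=> mU; apply: emeasurable_funM; first exact/measurable_EFinP.
  have mU' : measurable (X s @^-1` U : set (process_space X)).
    by have := mXs measurableT U mU; rewrite setTI.
  exact: (measurableT_comp (sm_kernel sm mU') mX0).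
have nuE U : measurable U -> nu U = (\int[Pr x]_o K o U)%E.
  move=> mU.
  set S := [set o | (T o < +oo)%E /\ U (X (fine (T o) + s) o)].
  transitivity (Pr x (G `&` S)); last rewrite (sm_markov sm x sT s0 hG mU).
    have mGS : measurable (G `&` S).
      by apply: measurableI; [exact: hG.1|exact: (stopped_position s0 sT mU).1].
    transitivity (\int[Pr x]_o (\1_(G `&` S) o)%:E)%E; last first.
      by rewrite integral_indic// setIT.
    rewrite /nu /= /pushforward /weighted_measure integral_mkcond.
    apply: eq_integral => o _; rewrite patchE /= !indicE.
    have [Do|Do] := boolP (o \in D); last first.
      rewrite if_same memNset// => -[Go [To _]].
      by move: Do; rewrite notin_setE; apply.
    have [UY|UY] := boolP (o \in Y s @^-1` U).
      move: UY; rewrite inE /= /Y Do => UX; rewrite mem_set//.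
      by rewrite inE in Do; split; [case: Do|split => //; case: Do].
    rewrite memNset// => -[_ [_ UX]]; move: UY; rewrite notin_setE; apply.
    by rewrite /= /Y Do.
  rewrite integral_mkcond; apply: eq_integral => o _; rewrite patchE KE indicE.
  by case: ifPn => Do; rewrite ?mul0e// mul1e Y0E// -inE.
have := ge0_integral_mixture mK nuE h0 mh.
rewrite (_ : (\int[nu]_y h y)%E = (\int[Pr x]_(o in D) h (X (fine (T o) + s) o))%E); last first.
  rewrite /nu ge0_integral_pushforward//; last exact: mY.
  rewrite preimage_setT ge0_integral_weighted//; last 2 first.
    by move=> o; exact: h0.
    exact: measurableT_comp (mY s0).
  rewrite [RHS]integral_mkcond; apply: eq_integral => o _ /=.
  by rewrite patchE indicE /Y; case: ifPn; rewrite ?mule1 ?mule0.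
move=> ->; rewrite [RHS]integral_mkcond; apply: eq_integral => o _.
rewrite /K ge0_integral_mscale// ge0_integral_pushforward//.
rewrite preimage_setT patchE /= indicE; case: ifPn; rewrite ?mul0e// inE => Do.
by rewrite mul1e Y0E.
Qed.

End stopped.

Lemma markov_event x r s G A : 0 <= r -> 0 <= s -> history X r G -> measurable A ->
  Pr x (G `&` X (r + s) @^-1` A) = (\int[Pr x]_(o in G) Pr (X r o) (X s @^-1` A))%E.
Proof.
move=> r0 s0 hG mA.
have := sm_markov sm x (stopping_time_cst r0) s0 (stopped_history_cst r0 hG) mA.
have -> : [set o : process_space X | (r%:E < +oo)%E] = setT.
  by apply/seteqP; split => // o _ /=; rewrite ltry.
rewrite setIT /= => <-; congr (Pr x (G `&` _)).
by apply/seteqP; split => [w Aw|w []//]; split; rewrite ?ltry.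
Qed.

End strong_markov_theory.

(** * Limits used for extinction probabilities *)

(** Continuity from below for a sequence that increases, and exhausts A, only
    outside of a null set N. *)
Lemma cvg_measure_modulo_null d (T : measurableType d) (R : realType)
    (m : {measure set T -> \bar R}) (N A : set T) (F : (set T)^nat) :
  measurable N -> m N = 0%E -> measurable A -> (forall n, measurable (F n)) ->
  (forall n, F n `\` N `<=` F n.+1) -> (forall n, F n `\` N `<=` A) ->
  A `\` N `<=` \bigcup_n F n ->
  m (F n) @[n --> \oo] --> m A.
Proof.
move=> mN N0 mA mF ndF FA AF.
have modN (B : set T) : measurable B -> m B = m (B `\` N).
  move=> mB; rewrite (measureDI m mB mN) [X in (_ + X)%E](_ : _ = 0%E) ?adde0//.
  by apply: subset_measure0 N0 => //; exact: measurableI.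
rewrite (modN A)// (_ : (fun n => _) = m \o (fun n => F n `\` N)); last first.
  by apply/funext => n /=; exact: modN.
have UE : A `\` N = \bigcup_n (F n `\` N).
  apply/seteqP; split => [x [Ax Nx]|x [n _ [Fx Nx]]].
    by have [n _ Fx] := AF x (conj Ax Nx); exists n.
  by split => //; exact: (FA n).
rewrite UE; apply: nondecreasing_cvg_mu.
- by move=> n; exact: measurableD.
- by rewrite -UE; exact: measurableD.
- by apply/nondecreasing_seqP => n; apply/subsetPset => x [Fx Nx]; split => //; exact: (ndF n).
Qed.

(** The exponent m = 0 (a type absent from the configuration) and the limit p = 0
    (a type that is almost surely alive at the given time) both occur. *)
Lemma cvg_powR (R : realType) (a : R^nat) (p m : R) : 0 <= m ->
  (forall n, 0 <= a n) -> a n @[n --> \oo] --> p -> a n `^ m @[n --> \oo] --> p `^ m.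
Proof.
move=> m0 a0 ap.
have p0 : 0 <= p.
  by rewrite -(cvg_lim _ ap)//; apply: limr_ge; [apply/cvg_ex; eexists; exact: ap|exact: nearW].
have [m_gt0|m_le0] := ltP 0 m; last first.
  have -> : m = 0 by apply/eqP; rewrite eq_le m_le0.
  under eq_fun do rewrite powRr0.
  by rewrite powRr0; exact: cvg_cst.
have [p_gt0|p_le0] := ltP 0 p.
  have cp : {for p, continuous (fun x : R => x `^ m)}.
    apply/differentiable_continuous/derivable1_diffP.
    by have [] := is_derive1_powR m p_gt0.
  exact: (@cvg_comp _ _ _ a (fun x : R => x `^ m) _ _ _ ap cp).
have p_eq0 : p = 0 by apply/eqP; rewrite eq_le p_le0.
rewrite p_eq0 powR0 ?gt_eqF// in ap *.
apply/cvgrPdist_lt => e e0.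
have /cvgrPdist_lt /(_ e e0) [r /= r0 hr] := powR_cvg0 m_gt0.
move/cvgrPdist_lt : ap => /(_ r r0) [N _ hN].
exists N => // n Nn; have [an|an] := ltP 0 (a n).
  by apply: hr => //; exact: hN.
have -> : a n = 0 by apply/eqP; rewrite eq_le an a0.
by rewrite powR0 ?gt_eqF// subrr normr0.
Qed.

Lemma cvg_prodr (R : realType) (k : nat) (F : 'I_k -> R^nat) (l : 'I_k -> R) :
  (forall i, F i n @[n --> \oo] --> l i) ->
  \prod_(i < k) F i n @[n --> \oo] --> \prod_(i < k) l i.
Proof.
move=> Fl; suff cS (s : seq 'I_k) :
  \prod_(i <- s) F i n @[n --> \oo] --> \prod_(i <- s) l i by exact: cS.
elim: s => [|i s IH].
  rewrite big_nil (_ : (fun n => _) = (fun=> 1)); first exact: cvg_cst.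
  by apply/funext => y; rewrite big_nil.
rewrite big_cons (_ : (fun n => _) = (fun n => F i n * \prod_(j <- s) F j n)).
  by apply: cvgM.
by apply/funext => y; rewrite big_cons.
Qed.

Lemma mnormalize_gt0 d (T : measurableType d) (R : realType)
    (m : {measure set T -> \bar R}) (P : probability T R) (r : R) A :
  0 < r -> m setT = r%:E -> mnormalize m P A = (m A * r^-1%:E)%E.
Proof. by move=> r0 mT; rewrite /mnormalize mT orbF eqe gt_eqF. Qed.

(** * Small masses and absorption at zero *)

Section extinction_theory.
Variables (R : realType) (d ell : nat).
Variable P : 'I_ell -> R -> R.-pker (euclidean R d) ~> (euclidean R d).
Variables (B : 'M[R]_ell) (beta : 'I_ell -> R).
Variable Pi : 'I_ell -> {measure set (euclidean R ell) -> \bar R}.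
Variable V : R -> ('I_ell -> euclidean R d -> R) -> 'I_ell -> euclidean R d -> R.
Variables (Omega : pointedType) (X : R -> Omega -> configurations R d ell).
Variable Pr : configurations R d ell -> probability (process_space X) R.
Variable x0 : euclidean R d.
Hypothesis bp : branching_parameters B beta Pi.
Hypothesis sp : superprocess P (mechanism B beta Pi) V Pr.
Local Notation conf := (configurations R d ell).
Implicit Types (mu : conf).

Let sm := sp_markov sp.
Local Notation mass t o := (total_mass (X t o)).
Local Notation Vcst t c i := (V t (fun _ _ => c) i x0).

Lemma measurable_mass t : 0 <= t ->
  measurable_fun setT (fun o : process_space X => mass t o).
Proof.
move=> t0; apply: (measurableT_comp (@measurable_total_mass R d ell)).
exact: measurable_cylinder.
Qed.

Lemma Vcst_const t c i x : 0 <= t -> 0 <= c -> V t (fun _ _ => c) i x = Vcst t c i.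
Proof.
move=> t0 c0; have bc := bounded_borel_cst d (fun _ : 'I_ell => c0).
by apply: (cumulant_solution_spatially_constant bp (sp_diffusion sp)
  (sp_cumulant sp bc).1).
Qed.

Lemma laplace_mass mu c t : 0 <= c -> 0 <= t ->
  (\int[Pr mu]_o (expR (- (c * mass t o)))%:E =
   (expR (- \sum_i Vcst t c i * fine (mu i setT)))%:E)%E.
Proof.
move=> c0 t0; have bc := bounded_borel_cst d (fun _ : 'I_ell => c0).
transitivity ('E_(Pr mu)[fun o => expR (- pairing (fun _ _ => c) (X t o))])%E.
  rewrite unlock; apply: eq_integral => o _; congr (expR (- _))%:E.
  by rewrite pairing_cst total_massE mulr_sumr.
rewrite (sp_laplace sp)//; congr (expR (- _))%:E.
rewrite -pairing_cst; apply: eq_bigr => i _.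
by apply: eq_Rintegral => x _; rewrite Vcst_const.
Qed.

(** The mean of 1 - exp(- |X_r|) is 1 - exp(- <V_r 1, mu>), which is at most a
    multiple of |mu|, uniformly for r <= t because V 1 is locally bounded; then
    Markov's inequality. *)
Lemma small_mass_stays_small t : 0 < t -> exists2 C, 0 <= C &
  forall r mu delta, 0 <= r <= t -> 0 < delta ->
  (Pr mu [set o | (delta <= mass r o)%R] <=
     (C * total_mass mu / (1 - expR (- delta)))%:E)%E.
Proof.
move=> t0; have bc := bounded_borel_cst d (fun _ : 'I_ell => @ler01 R).
have [C0 hC0] := cs_locally_bounded (sp_cumulant sp bc).1 t0.
exists (Num.max C0 0); first by rewrite le_max lexx orbT.
move=> r mu delta r0t delta0; have /andP[r0 rt] := r0t.
set C := Num.max C0 0; pose A : set (process_space X) := [set o | delta <= mass r o].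
rewrite -/A.
have C1 i : Vcst r 1 i <= C.
  by rewrite le_max (le_trans (ler_norm _))// hC0.
have q0 : 0 < 1 - expR (- delta) by rewrite subr_gt0 expR_lt1 oppr_lt0.
have mA : measurable A.
  have := measurable_mass r0 measurableT (measurable_itv `[delta, +oo[).
  by rewrite setTI; congr measurable; apply/seteqP; split => o /=; rewrite in_itv/= andbT.
have mexp : measurable_fun setT (fun o : process_space X => (expR (- (1 * mass r o)))%:E).
  apply/measurable_EFinP; apply: measurableT_comp => //; apply: measurable_funN.
  by apply: measurable_funM => //; exact: measurable_mass.
have : (\int[Pr mu]_o ((expR (- (1 * mass r o)))%:E +
    (1 - expR (- delta))%:E * (\1_A o)%:E) <= 1)%E.
  apply: (@le_trans _ _ (\int[Pr mu]_o 1%:E)%E); last first.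
    by rewrite integral_cst// mul1e; exact: (probability_le1 (Pr mu) measurableT).
  apply: ge0_le_integral => //.
  - by move=> o _; rewrite -EFinM -EFinD lee_fin addr_ge0 ?expR_ge0// mulr_ge0// ltW.
  - apply: emeasurable_funD => //; apply: emeasurable_funM => //.
    by apply/measurable_EFinP; exact: measurable_indic.
  - move=> o _; rewrite -EFinM -EFinD lee_fin mul1r indicE.
    have [Ao|Ao] := boolP (o \in A).
      rewrite mulr1 -lerBrDr opprB addrC subrK ler_expR lerN2.
      by rewrite inE in Ao.
    by rewrite mulr0 addr0 expR_le1 oppr_le0 total_mass_ge0.
rewrite ge0_integralD//; last 2 first.
- by move=> o _; rewrite -EFinM lee_fin mulr_ge0// ltW.
- apply: emeasurable_funM => //.
  by apply/measurable_EFinP; exact: measurable_indic.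
rewrite ge0_integralZl//; last 2 first.
- by apply/measurable_EFinP; exact: measurable_indic.
- by rewrite lee_fin ltW.
have Afin : Pr mu A \is a fin_num by exact: fin_num_measure.
have -> : (\int[Pr mu]_o (\1_A o)%:E = (fine (Pr mu A))%:E)%E.
  by rewrite integral_indic// setIT; exact/esym/fineK.
rewrite laplace_mass// -EFinM -EFinD lee_fin => h.
rewrite -(fineK Afin) lee_fin ler_pdivlMr//.
have e1 : 1 - C * total_mass mu <= expR (- \sum_i Vcst r 1 i * fine (mu i setT)).
  apply: le_trans (expR_ge1Dx _); rewrite lerD2l lerN2 total_massE mulr_sumr.
  by apply: ler_sum => i _; rewrite ler_wpM2r// fine_ge0.
by rewrite mulrC; lra.
Qed.

(** Dyadic grids are nested, so that these events increase with n. *)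
Definition small_on_grid (e t : R) (n : nat) : set (process_space X) :=
  \big[setU/set0]_(k < 2 ^ n) [set o | mass (k%:R * (t / (2 ^ n)%:R)) o < e].

Lemma small_on_gridP e t n o : small_on_grid e t n o <->
  exists2 k, (k < 2 ^ n)%N & mass (k%:R * (t / (2 ^ n)%:R)) o < e.
Proof.
rewrite /small_on_grid -(bigcup_mkord _ (fun k => [set o | mass (k%:R * (t / (2 ^ n)%:R)) o < e])).
by split => [[k kn ?]|[k kn ?]]; exists k.
Qed.

Lemma small_on_grid_nondecreasing e t n : small_on_grid e t n `<=` small_on_grid e t n.+1.
Proof.
move=> o /small_on_gridP[k kn ko]; apply/small_on_gridP; exists (2 * k)%N.
  by rewrite expnS ltn_pmul2l.
rewrite (_ : _ * _ = k%:R * (t / (2 ^ n)%:R))//.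
rewrite expnS !natrM; field.
by rewrite pnatr_eq0 expn_eq0.
Qed.

Lemma grid_time_itv (t : R) n k : 0 <= t -> (k < 2 ^ n)%N -> 0 <= k%:R * (t / (2 ^ n)%:R) <= t.
Proof.
move=> t0 kn; have p0 : 0 < (2 ^ n)%:R :> R by rewrite ltr0n expn_gt0.
rewrite mulr_ge0 ?divr_ge0//= mulrCA ler_piMr// ler_pdivrMr// mul1r ler_nat.
exact: ltnW.
Qed.

Lemma measurable_mass_lt t e : 0 <= t ->
  measurable ([set o | mass t o < e] : set (process_space X)).
Proof.
move=> t0; have := measurable_mass t0 measurableT (measurable_itv `]-oo, e[).
by rewrite setTI; congr measurable; apply/seteqP; split => o /=; rewrite in_itv.
Qed.

Lemma measurable_mass_ge t e : 0 <= t ->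
  measurable ([set o | e <= mass t o] : set (process_space X)).
Proof.
move=> t0; have := measurable_mass t0 measurableT (measurable_itv `[e, +oo[).
by rewrite setTI; congr measurable; apply/seteqP; split => o /=; rewrite in_itv/= andbT.
Qed.

Lemma measurable_small_on_grid e t n : 0 <= t -> measurable (small_on_grid e t n).
Proof.
move=> t0; apply: bigsetU_measurable => k _; apply: measurable_mass_lt.
by have /andP[] := grid_time_itv t0 (ltn_ord k).
Qed.

(** Splitting along the first grid time at which the mass is small, the Markov
    property at that time and [small_mass_stays_small] bound each piece by its
    probability times a constant independent of the grid. *)
Lemma grid_bound t mu : 0 < t -> exists2 C, 0 <= C &
  forall e delta n, 0 < e -> 0 < delta ->
  (Pr mu (small_on_grid e t n `&` [set o | (delta <= mass t o)%R]) <=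
     (C * e / (1 - expR (- delta)))%:E)%E.
Proof.
move=> t0; have [C C0 hC] := small_mass_stays_small t0.
exists C => // e delta n e0 delta0.
have t0' := ltW t0.
have q0 : 0 < 1 - expR (- delta) by rewrite subr_gt0 expR_lt1 oppr_lt0.
pose Dl : set (process_space X) := [set o | delta <= mass t o].
pose Dc : set conf := [set nu | delta <= total_mass nu].
have mDc : measurable Dc.
  have := @measurable_total_mass R d ell measurableT _ (measurable_itv `[delta, +oo[).
  by rewrite setTI; congr measurable; apply/seteqP; split => nu /=; rewrite in_itv/= andbT.
pose time k : R := k%:R * (t / (2 ^ n)%:R).
pose A k : set (process_space X) := [set o | mass (time k) o < e].
pose c : R := C * e / (1 - expR (- delta)).
have c0 : 0 <= c by rewrite divr_ge0 ?mulr_ge0// ltW.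
have timeP k : (k < 2 ^ n)%N -> 0 <= time k <= t by exact: grid_time_itv.
have time0 k : 0 <= time k by rewrite mulr_ge0// divr_ge0.
have mA k : measurable (A k) by apply: measurable_mass_lt.
have hA k : history X (time k) (seqDU A k).
  have hAj j : (j <= k)%N -> history X (time k) (A j).
    move=> jk; pose Be : set conf := [set nu | total_mass nu < e].
    have -> : A j = X (time j) @^-1` Be by [].
    apply: history_cylinder; first by rewrite time0 ler_wpM2r ?ler_nat// divr_ge0.
    have := @measurable_total_mass R d ell measurableT _ (measurable_itv `]-oo, e[).
    by rewrite setTI; congr measurable; apply/seteqP; split => nu /=; rewrite in_itv.
  rewrite historyE; apply: measurableD; first exact: hAj.
  by apply: bigsetU_measurable => j _; apply: hAj; exact: ltnW.
have step k : (k < 2 ^ n)%N ->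
    (Pr mu (seqDU A k `&` Dl) <= c%:E * Pr mu (seqDU A k))%E.
  move=> kn; have /andP[_ kt] := timeP _ kn.
  have -> : Dl = X (time k + (t - time k)) @^-1` Dc by rewrite addrC subrK.
  have r0 : 0 <= t - time k by rewrite subr_ge0.
  rewrite (markov_event (sp_markov sp))//.
  have mAk : measurable (seqDU A k) by exact: history_measurable (hA k).
  apply: (@le_trans _ _ (\int[Pr mu]_(o in seqDU A k) c%:E)%E); last first.
    by rewrite integral_cst.
  apply: ge0_le_integral => //.
  - apply: measurable_funTS.
    have mX := measurable_cylinder (X := X) (time0 k).
    have mDr : measurable (X (t - time k) @^-1` Dc : set (process_space X)).
      by rewrite -[X in measurable X]setTI; exact: measurable_cylinder.
    exact: (measurableT_comp (sm_kernel (sp_markov sp) mDr) mX).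
  - move=> o [Ao _]; apply: (le_trans (hC _ _ _ _ delta0)).
      by rewrite r0 gerBl time0.
    by rewrite lee_fin ler_wpM2r ?invr_ge0 ?(ltW q0)// ler_wpM2l// ltW.
rewrite /small_on_grid -/Dl (bigsetU_seqDU A) big_distrl/=.
rewrite measure_bigsetU_ord//; last 2 first.
- by move=> k; apply: measurableI; [exact: history_measurable (hA k)|exact: measurable_mass_ge].
- move=> i j _ _ [w [[Ai _] [Aj _]]].
  by apply/val_inj; apply: (@trivIset_seqDU _ A) => //; exists w.
apply: (@le_trans _ _ (\sum_(k < 2 ^ n) c%:E * Pr mu (seqDU A k))%E).
  by apply: lee_sum => k _; exact: step.
rewrite -ge0_sume_distrr//.
rewrite -measure_bigsetU_ord//; last 2 first.
- by move=> k; exact: history_measurable (hA k).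
- move=> i j _ _ [w [Ai Aj]].
  by apply/val_inj; apply: (@trivIset_seqDU _ A) => //; exists w.
rewrite -[leRHS]mule1; apply: lee_wpmul2l; first by rewrite lee_fin.
apply: probability_le1; apply: bigsetU_measurable => k _.
exact: history_measurable (hA k).
Qed.

(** By right-continuity this contains the event that the mass vanishes at some time
    before t and is positive at t: after a zero the mass stays small for a while,
    which any sufficiently fine grid detects. Only countably many times enter,
    which makes it measurable. *)
Definition resurrection (t : R) : set (process_space X) :=
  (\bigcap_j \bigcup_n small_on_grid j.+1%:R^-1 t n) `&` [set o | 0 < mass t o].

Lemma measurable_mass_gt t e : 0 <= t ->
  measurable ([set o | e < mass t o] : set (process_space X)).
Proof.
move=> t0; have := measurable_mass t0 measurableT (measurable_itv `]e, +oo[).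
by rewrite setTI; congr measurable; apply/seteqP; split => o /=; rewrite in_itv/= andbT.
Qed.

Lemma measurable_resurrection t : 0 <= t -> measurable (resurrection t).
Proof.
move=> t0; apply: measurableI; last exact: measurable_mass_gt.
apply: bigcapT_measurable => j; apply: bigcupT_measurable => n.
exact: measurable_small_on_grid.
Qed.

(** For each lower bound delta on the final mass, [grid_bound] bounds the
    probability by a multiple of e = 1/(j+1), for every j. *)
Lemma resurrection_null t mu : 0 < t -> Pr mu (resurrection t) = 0%E.
Proof.
move=> t0; have t0' := ltW t0; have [C C0 hC] := grid_bound mu t0.
pose F i := resurrection t `&` [set o | i.+1%:R^-1 <= mass t o].
have mF i : measurable (F i).
  by apply: measurableI; [exact: measurable_resurrection|exact: measurable_mass_ge].
have -> : resurrection t = \bigcup_i F i.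
  apply/seteqP; split => [w rw|w [i _ []]//].
  have [_ m0] := rw; rewrite /= in m0.
  have [i _ /(_ i (leqnn i)) im] := near_infty_natSinv_lt (PosNum m0).
  by exists i => //; split => //=; exact: ltW.
suff F0 i : Pr mu (F i) = 0%E.
  apply/negligibleP; first exact: bigcupT_measurable.
  apply: negligible_bigcup => i.
  by apply/negligibleP; [exact: mF|exact: F0].
pose delta : R := i.+1%:R^-1.
have delta0 : 0 < delta by rewrite invr_gt0.
pose q := 1 - expR (- delta).
have q0 : 0 < q by rewrite subr_gt0 expR_lt1 oppr_lt0.
have Ffin : Pr mu (F i) \is a fin_num by exact: fin_num_measure.
have bound j : fine (Pr mu (F i)) <= C * j.+1%:R^-1 / q.
  rewrite -lee_fin (fineK Ffin).
  pose G n := small_on_grid j.+1%:R^-1 t n `&` [set o | delta <= mass t o].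
  have mG n : measurable (G n).
    by apply: measurableI; [exact: measurable_small_on_grid|exact: measurable_mass_ge].
  apply: (@le_trans _ _ (Pr mu (\bigcup_n G n))).
    apply: le_measure; rewrite ?inE//; first exact: bigcupT_measurable.
    by move=> w [[/(_ j I)[n _ wn] _] dw]; exists n.
  have cv : Pr mu (G n) @[n --> \oo] --> Pr mu (\bigcup_n G n).
    apply: nondecreasing_cvg_mu => //; first exact: bigcupT_measurable.
    apply/nondecreasing_seqP => n; apply/subsetPset => w [wn dw]; split => //.
    exact: small_on_grid_nondecreasing.
  rewrite -(cvg_lim _ cv)//; apply: lime_le; first by apply/cvg_ex; eexists; exact: cv.
  by apply: nearW => n; apply: hC.
have cv : C * j.+1%:R^-1 / q @[j --> \oo] --> C * 0 / q.
  by apply: cvgM; [apply: cvgM; [exact: cvg_cst|exact: cvg_harmonic]|exact: cvg_cst].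
have p0 : fine (Pr mu (F i)) <= 0.
  rewrite [leRHS](_ : _ = C * 0 / q); last by rewrite mulr0 mul0r.
  rewrite -(cvg_lim _ cv)//; apply: limr_ge; first by apply/cvg_ex; eexists; exact: cv.
  exact: nearW.
by apply/eqP; rewrite -(fineK Ffin) eqe eq_le p0 fine_ge0.
Qed.

(** Positive rational times are enough, since right-continuity determines the mass
    at t from later rational times. *)
Definition resurrections : set (process_space X) :=
  \bigcup_k \bigcup_j resurrection (j.+1%:R / k.+1%:R).

Lemma measurable_resurrections : measurable resurrections.
Proof.
apply: bigcupT_measurable => k; apply: bigcupT_measurable => j.
by apply: measurable_resurrection; rewrite divr_ge0.
Qed.

Lemma resurrections_null mu : Pr mu resurrections = 0%E.
Proof.
apply/negligibleP; first exact: measurable_resurrections.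
apply: negligible_bigcup => k; apply: negligible_bigcup => j.
apply/negligibleP; first by apply: measurable_resurrection; rewrite divr_ge0.
by apply: resurrection_null; rewrite divr_gt0.
Qed.

Lemma mass_right_continuous o t : 0 <= t -> mass s o @[s --> t^'+] --> mass t o.
Proof.
move=> t0; apply: (@cvg_comp _ _ _ (fun s => X s o) (@total_mass R d ell)
  (at_right t) _ _ (sp_paths sp t0)).
exact: (@continuous_total_mass R d ell (X t o)).
Qed.

Lemma grid_after (r h : R) : 0 <= r -> 0 < h ->
  r < (Num.truncn (r / h)).+1%:R * h <= r + h.
Proof.
move=> r0 h0; have /truncn_itv /andP[l u] : 0 <= r / h by rewrite divr_ge0// ltW.
rewrite -ltr_pdivrMr// u/= -natr1 mulrDl mul1r lerD2r -ler_pdivlMr//.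
Qed.

Lemma right_near0 o r e : 0 <= r -> mass r o < e -> exists2 eta, 0 < eta &
  forall s, r < s < r + eta -> mass s o < e.
Proof.
move=> r0 re; have := mass_right_continuous r0 (o := o).
move=> /cvgrPdist_lt /(_ (e - mass r o)).
rewrite subr_gt0 => /(_ re) [eta /= eta0 h].
exists eta => // s /andP[rs se].
have := h s; rewrite /ball_/= distrC ger0_norm ?subr_ge0 ?(ltW rs)//.
rewrite ltrBlDl => /(_ se rs); rewrite ltr_norml => /andP[+ _].
lra.
Qed.

(** At rational times after r the mass vanishes, as the path would belong to a
    resurrection event otherwise; right-continuity at tau concludes. *)
Lemma absorption o r tau : ~ resurrections o -> 0 <= r -> r < tau ->
  mass r o = 0 -> mass tau o = 0.
Proof.
move=> no r0 rtau mr0.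
have onGrid k j : r < j.+1%:R / k.+1%:R -> mass (j.+1%:R / k.+1%:R) o = 0.
  set s := _ / _ => rs; apply: contrapT => ms.
  have s0 : 0 < s by exact: le_lt_trans rs.
  apply: no; exists k => //; exists j => //; split; last first.
    by rewrite /= lt_neqAle total_mass_ge0 eq_sym andbT; exact/eqP.
  move=> i _.
  have [|eta eta0 h] := @right_near0 o r i.+1%:R^-1 r0; first by rewrite mr0.
  (* The first point of the grid of mesh s / 2^n after r lies both in the interval
     where the mass is small and before s. *)
  pose m := Num.min eta (s - r).
  have m0 : 0 < m by rewrite lt_min eta0 subr_gt0.
  pose n := (Num.truncn (s / m)).+1.
  have p0 : 0 < (2 ^ n)%:R :> R by rewrite ltr0n expn_gt0.
  have hm : s / (2 ^ n)%:R < m.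
    rewrite ltr_pdivrMr// -ltr_pdivrMl// mulrC.
    apply: (@lt_trans _ _ n%:R).
      by have /truncn_itv/andP[] : 0 <= s / m by rewrite divr_ge0// ltW.
    by rewrite ltr_nat ltn_expl.
  have h0 : 0 < s / (2 ^ n)%:R by rewrite divr_gt0.
  have /andP[ru ur] := grid_after r0 h0.
  set u := (X in r < X) in ru ur.
  exists n => //; apply/small_on_gridP; exists (Num.truncn (r / (s / (2 ^ n)%:R))).+1.
    have us : u < s.
      apply: (le_lt_trans ur); rewrite -ltrBrDl; apply: (lt_le_trans hm).
      by rewrite ge_min lexx orbT.
    move: us; rewrite /u mulrA ltr_pdivrMr// mulrC ltr_pM2l// ltr_nat//.
  apply: h; rewrite ru/=; apply: (le_lt_trans ur); rewrite ltrD2l.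
  by apply: (lt_le_trans hm); rewrite ge_min lexx.
apply/eqP; rewrite eq_le total_mass_ge0 andbT leNgt; apply/negP => mtau.
have tau0 : 0 <= tau by exact/ltW/(le_lt_trans r0).
have := mass_right_continuous tau0 (o := o).
move=> /cvgrPdist_lt /(_ _ mtau)[eta /= eta0 h].
have [k _ /(_ k (leqnn k)) keta] := near_infty_natSinv_lt (PosNum eta0).
have k0 : 0 < k.+1%:R^-1 :> R by rewrite invr_gt0.
have /andP[tu ut] := grid_after tau0 k0.
set u := (X in tau < X) in tu ut.
have bu : `|tau - u| < eta.
  rewrite distrC ger0_norm ?subr_ge0 ?(ltW tu)// ltrBlDl.
  by rewrite (le_lt_trans ut)// ltrD2l.
have := h u bu tu; rewrite (onGrid _ _ (lt_trans rtau tu)) subr0.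
by rewrite ger0_norm ?ltxx ?total_mass_ge0.
Qed.

(** * The extinction probability *)

Hypothesis mE : measurable (extinction X).
Local Notation dead t := ([set o | mass t o = 0] : set (process_space X)).

Lemma measurable_dead t : 0 <= t -> measurable (dead t).
Proof.
move=> t0; have := measurable_mass t0 measurableT (measurable_set1 0).
by rewrite setTI.
Qed.

Lemma measurable_path_preimage s (A : set conf) : 0 <= s -> measurable A ->
  measurable (X s @^-1` A : set (process_space X)).
Proof.
by move=> s0 mA; rewrite -[X in measurable X]setTI; exact: measurable_cylinder.
Qed.

Lemma measurable_zero_mass : measurable ([set nu | total_mass nu = 0] : set conf).
Proof.
by have := @measurable_total_mass R d ell measurableT _ (measurable_set1 0); rewrite setTI.
Qed.

(** By absorption, extinction happens if and only if the mass vanishes at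
    T + s + n + 1 for some n, and these events increase with n, up to the null event
    of resurrections. The shift by one makes the times positive, as the definition
    of extinction requires. *)
Lemma shifted_extinction x T (s : R) (G : set (process_space X)) :
  stopping_time X T -> 0 <= s -> measurable G ->
  (forall o, G o -> (T o < +oo)%E) ->
  Pr x (G `&` [set o | mass (fine (T o) + (s + n.+1%:R)) o = 0]) @[n --> \oo] -->
  Pr x (G `&` extinction X).
Proof.
move=> sT s0 mG GT.
have T0 o : 0 <= fine (T o) by rewrite fine_ge0// sT.1.
have later0 o n : 0 < fine (T o) + (s + n.+1%:R) by rewrite ltr_wpDl// ltr_wpDl.
pose F n : set (process_space X) :=
  G `&` [set o | mass (fine (T o) + (s + n.+1%:R)) o = 0].
apply: (@cvg_measure_modulo_null _ _ _ (Pr x) resurrections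
  (G `&` extinction X) F).
- exact: measurable_resurrections.
- exact: resurrections_null.
- exact: measurableI.
- move=> n.
  have sn0 : 0 <= s + n.+1%:R by rewrite addr_ge0.
  have [mP _] := stopped_position sm sn0 sT measurable_zero_mass.
  rewrite (_ : F n = G `&`
    [set o | (T o < +oo)%E /\
      [set nu | total_mass nu = 0] (X (fine (T o) + (s + n.+1%:R)) o)]).
    exact: measurableI.
  by apply/seteqP; split => o /= [Go Zo]; split => //; [split => //; exact: GT|case: Zo].
- move=> n w [[Gw w0] nw]; split => //.
  apply: (absorption nw _ _ w0); first exact: ltW.
  by rewrite !ltrD2l ltr_nat.
- by move=> n w [[Gw w0] _]; split => //; exists (fine (T w) + (s + n.+1%:R)).
- move=> w [[Gw [r r0 w0]] nw]; exists (Num.truncn r) => //; split => //.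
  apply: (absorption nw (ltW r0) _ w0).
  have /truncn_itv/andP[_ ur] := ltW r0.
  by apply: (lt_le_trans ur); rewrite addrA lerDr addr_ge0.
Qed.

Lemma cvg_dead_extinction x : Pr x (dead n.+1%:R) @[n --> \oo] --> Pr x (extinction X).
Proof.
have := shifted_extinction (x := x) (stopping_time_cst X (lexx 0)) (lexx 0) measurableT
  (fun o _ => ltry 0).
rewrite setTI (_ : (fun n => _) = (fun n => Pr x (dead n.+1%:R)))//.
by apply/funext => n; rewrite setTI /= !add0r.
Qed.

(** exp(- n |X_t|) decreases to the indicator of a vanishing mass. *)
Lemma cvg_laplace_dead (x : conf) t : 0 <= t ->
  expR (- \sum_i Vcst t n%:R i * fine (x i setT)) @[n --> \oo] --> fine (Pr x (dead t)).
Proof.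
move=> t0.
suff : (expR (- \sum_i Vcst t n%:R i * fine (x i setT)))%:E @[n --> \oo] -->
    (fine (Pr x (dead t)))%:E by move/fine_cvg.
pose f n (o : process_space X) : \bar R := (expR (- (n%:R * mass t o)))%:E.
have mf n : measurable_fun setT (f n).
  apply/measurable_EFinP; apply: measurableT_comp => //; apply: measurable_funN.
  by apply: measurable_funM => //; exact: measurable_mass.
have ->: (fun n => (expR (- \sum_i Vcst t n%:R i * fine (x i setT)))%:E) =
    (fun n => \int[Pr x]_o f n o)%E.
  by apply/funext => n; rewrite -laplace_mass.
have -> : (fine (Pr x (dead t)))%:E = (\int[Pr x]_o (\1_(dead t) o)%:E)%E.
  rewrite integral_indic ?setIT//; last exact: measurable_dead.
  by apply: fineK; apply: fin_num_measure; exact: measurable_dead.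
have [] := @dominated_convergence _ _ _ (Pr x) setT measurableT f
  (fun o => (\1_(dead t) o)%:E) (fun=> 1%E) mf; last by move=> _ _; apply.
- by apply/measurable_EFinP; apply: measurable_indic; exact: measurable_dead.
- apply: aeW => o _; suff h : expR (- (n%:R * mass t o)) @[n --> \oo] --> (\1_(dead t) o : R).
    by apply/cvg_EFin; [exact: nearW|exact: h].
  rewrite indicE; have [m0|m0] := eqVneq (mass t o) 0.
    rewrite mem_set// (_ : (fun n => _) = (fun=> 1)); first exact: cvg_cst.
    by apply/funext => n /=; rewrite m0 mulr0 oppr0 expR0.
  rewrite memNset; last exact/eqP.
  have o1 : 0 < mass t o by rewrite lt_neqAle eq_sym m0 total_mass_ge0.
  rewrite (_ : (fun n => _) = (fun n => expR (- mass t o) ^+ n)).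
    by apply: cvg_expr; rewrite ger0_norm ?expR_ge0// expR_lt1 oppr_lt0.
  by apply/funext => n; rewrite mulrC -mulNr expRM powR_mulrn ?expR_ge0.
- exact: finite_measure_integrable_cst.
- apply: aeW => o n _; rewrite /f /= lee_fin ger0_norm ?expR_ge0//.
  by rewrite expR_le1 oppr_le0 mulr_ge0// total_mass_ge0.
Qed.

(** The exponent in [cvg_laplace_dead] is linear in the component masses of x, and
    for x = e_i delta_x0 it is the i-th coefficient. *)
Lemma dead_probability (x : conf) t : 0 <= t ->
  fine (Pr x (dead t)) =
  \prod_(i < ell) fine (Pr (point_mass i x0) (dead t)) `^ fine (x i setT).
Proof.
move=> t0.
have cv1 := cvg_laplace_dead (x := x) t0.
apply: (cvg_unique _ cv1) => //.
rewrite (_ : (fun n => _) =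
    (fun n => \prod_(i < ell) expR (- Vcst t n%:R i) `^ fine (x i setT))); last first.
  by apply/funext => n; rewrite -sumrN expR_sum; apply: eq_bigr => i _; rewrite -mulNr expRM.
apply: cvg_prodr => i; apply: cvg_powR; first exact: fine_ge0.
  by move=> n; exact: expR_ge0.
have := cvg_laplace_dead (x := point_mass i x0) t0.
rewrite (_ : (fun n => expR (- \sum_j _)) = (fun n => expR (- Vcst t n%:R i)))//.
apply/funext => n; rewrite -(pairing_cst (fun j => Vcst t n%:R j)).
by rewrite pairing_point_mass.
Qed.

Lemma extinction_probability_prod (x : conf) :
  fine (Pr x (extinction X)) =
  \prod_(i < ell) fine (Pr (point_mass i x0) (extinction X)) `^ fine (x i setT).
Proof.
have cv y : fine (Pr y (dead n.+1%:R)) @[n --> \oo] --> fine (Pr y (extinction X)).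
  have := cvg_dead_extinction (x := y).
  by rewrite -[X in _ --> X](fineK (fin_num_measure _ _ mE)) => /fine_cvg.
apply: (cvg_unique _ (cv x)) => //.
rewrite (_ : (fun n => _) = (fun n => \prod_(i < ell)
    fine (Pr (point_mass i x0) (dead n.+1%:R)) `^ fine (x i setT))).
  apply: cvg_prodr => i; apply: cvg_powR; [exact: fine_ge0| |exact: cv].
  by move=> n; exact: fine_ge0.
by apply/funext => n; exact: dead_probability.
Qed.

Hypothesis w_fin : forall i, (0 < extinction_exponent Pr x0 i < +oo)%E.

Let w : 'cV[R]_ell := \col_i fine (extinction_exponent Pr x0 i).
Let wfun : 'I_ell -> euclidean R d -> R := fun i _ => w i 0.
Local Notation psi := (mechanism B beta Pi).

Lemma extinction_exponent_orthant : orthant w.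
Proof. by move=> i; rewrite mxE fine_ge0//; have /andP[/ltW] := w_fin i. Qed.

Let w0 : orthant w := extinction_exponent_orthant.

Let bw : bounded_borel_nonneg wfun.
Proof. exact: bounded_borel_cst. Qed.

Lemma extinction_probability (x : conf) :
  Pr x (extinction X) = (expR (- pairing wfun x))%:E.
Proof.
rewrite -[LHS](fineK (fin_num_measure _ _ mE)) extinction_probability_prod.
congr EFin; rewrite pairing_cst -sumrN expR_sum; apply: eq_bigr => i _.
rewrite -mulNr expRM mxE; congr (_ `^ _).
have /andP[_] := w_fin i; rewrite /extinction_exponent.
have pfin : Pr (point_mass i x0) (extinction X) \is a fin_num by exact: fin_num_measure.
have : (0 <= Pr (point_mass i x0) (extinction X))%E by exact: measure_ge0.
rewrite -(fineK pfin); set p := fine _; rewrite lee_fin le_eqVlt => /predU1P[<-|p0].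
  by rewrite /lne lexx.
by move=> _; rewrite lne_EFin//= opprK lnK// posrE.
Qed.

(** * The Markov property on the event of extinction *)

Section at_stopping_time.
Variables (T : Omega -> \bar R) (sT : stopping_time X T).
Variables (G : set (process_space X)) (hG : stopped_history (X := X) T G).
Variable x : conf.
Let D : set (process_space X) := G `&` [set o | (T o < +oo)%E].

Let mD : measurable D.
Proof. by apply: measurableI; [exact: hG.1|exact: (finite_time_measurable sm sT).1]. Qed.

Let mkernel (S : set (process_space X)) : measurable S ->
  measurable_fun D (fun o => Pr (X (fine (T o)) o) S).
Proof.
move=> mS; have [Z mZ ZE] := stopped_position_extension sm sT hG (lexx 0).
apply: (eq_measurable_fun (fun o => Pr (Z o) S)).
  by move=> o; rewrite inE => Do; rewrite ZE// addr0.
by apply: measurable_funTS; exact: (measurableT_comp (sm_kernel sm mS) mZ).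
Qed.

(** The event that the mass vanishes at time T + s + n + 1 is handled by the strong
    Markov property at T + s, then at T; letting n go to infinity turns it into
    extinction on both sides. *)
Lemma strong_markov_extinction s (A : set conf) : 0 <= s -> measurable A ->
  Pr x (G `&` [set o | (T o < +oo)%E /\ A (X (fine (T o) + s) o)] `&` extinction X) =
  (\int[Pr x]_(o in D) Pr (X (fine (T o)) o) (X s @^-1` A `&` extinction X))%E.
Proof.
move=> s0 mA.
pose H := [set o : process_space X | (T o < +oo)%E /\ A (X (fine (T o) + s) o)].
have hGH : stopped_history (X := X) (fun o => (T o + s%:E)%E) (G `&` H).
  by apply: stopped_historyI; [exact: stopped_historyD|exact: (stopped_position sm s0 sT mA)].
have sTs := stopping_timeD s0 sT.
have mXA := measurable_path_preimage s0 mA.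
pose F n o := Pr (X (fine (T o)) o) (X s @^-1` A `&` dead (s + n.+1%:R)).
have mdead n : measurable (X s @^-1` A `&` dead (s + n.+1%:R) : set (process_space X)).
  by apply: measurableI => //; apply: measurable_dead; rewrite addr_ge0.
have FE n : Pr x (G `&` H `&` [set o | mass (fine (T o) + (s + n.+1%:R)) o = 0]) =
    (\int[Pr x]_(o in D) F n o)%E.
  have n0 : 0 <= n.+1%:R :> R by [].
  pose k (y : conf) : \bar R := ((\1_A y)%:E * Pr y (dead n.+1%:R))%E.
  have k0 y : (0 <= k y)%E by rewrite mule_ge0// lee_fin.
  have mk : measurable_fun setT k.
    apply: emeasurable_funM; first by apply/measurable_EFinP; exact: measurable_indic.
    by apply: (sm_kernel sm); exact: measurable_dead.
  have h1 := sm_markov sm x sTs n0 hGH measurable_zero_mass.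
  have finE (o : process_space X) : (T o < +oo)%E ->
      fine (T o + s%:E)%E = fine (T o) + s /\ (T o + s%:E < +oo)%E.
    by case: (T o) (sT.1 o) => [r| |]//= _; rewrite !ltry.
  transitivity (Pr x (G `&` H `&` [set o : process_space X | (T o + s%:E < +oo)%E /\
      [set nu | total_mass nu = 0] (X (fine (T o + s%:E)%E + n.+1%:R) o)])).
    congr (Pr x _); apply/seteqP; split => o /= [[Go [To Ao]] mo].
      by have [e1 e2] := finE o To; rewrite e1 e2 -addrA.
    by have [e1 e2] := finE o To; move: mo; rewrite e1 -addrA => -[].
  rewrite h1.
  transitivity (\int[Pr x]_(o in D) k (X (fine (T o) + s) o))%E.
    rewrite [LHS]integral_mkcond [RHS]integral_mkcond; apply: eq_integral => o _.
    rewrite !patchE /k indicE.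
    have [Do|Do] := boolP (o \in D); last first.
      rewrite memNset// => -[[Go [To _]] _].
      by move: Do; rewrite notin_setE; apply.
    rewrite inE in Do; have [Go To] := Do; have [e1 e2] := finE o To.
    have [Ao|Ao] := boolP (X (fine (T o) + s) o \in A).
      rewrite mem_set; first by rewrite mul1e e1.
      by split => //; split => //; split => //; rewrite inE in Ao.
    rewrite mul0e memNset// => -[[_ [_ Ao']] _].
    by move: Ao; rewrite notin_setE; apply.
  rewrite (strong_markov_integral sm sT hG x s0 k0 mk); apply: eq_integral => o _.
  have hs : history X s (X s @^-1` A) by apply: history_cylinder => //; rewrite s0 lexx.
  have h2 := markov_event sm (X (fine (T o)) o) s0 n0 hs measurable_zero_mass.
  rewrite /F [RHS]h2 [RHS]integral_mkcond.
  apply: eq_integral => o' _; rewrite /k patchE indicE.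
  have [Ao|Ao] := boolP (o' \in X s @^-1` A).
    by rewrite inE in Ao; rewrite mem_set// mul1e.
  by rewrite notin_setE in Ao; rewrite memNset// mul0e.
have GHT o : (G `&` H) o -> (T o < +oo)%E by move=> [_ []].
have cvL := shifted_extinction (x := x) sT s0 hGH.1 GHT.
apply: (cvg_unique _ cvL) => //.
rewrite (_ : (fun n => _) = (fun n => \int[Pr x]_(o in D) F n o)%E); last first.
  by apply/funext => n; exact: FE.
have [] := @dominated_convergence _ _ _ (Pr x) D mD F
  (fun o => Pr (X (fine (T o)) o) (X s @^-1` A `&` extinction X)) (fun=> 1%E);
  last by move=> _ _; apply.
- by move=> n; exact: mkernel.
- by apply: mkernel; exact: measurableI.
- apply: aeW => o _; rewrite /F.
  have := shifted_extinction (x := X (fine (T o)) o)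
    (stopping_time_cst X s0) (lexx 0) mXA (fun o' _ => ltry s).
  by under eq_fun do rewrite /= add0r.
- apply: (@integrableS _ _ _ _ setT) => //; exact: finite_measure_integrable_cst.
- apply: aeW => o n _; rewrite gee0_abs//; exact: probability_le1.
Qed.

End at_stopping_time.

(** Under Pr y the initial configuration is almost surely y, so events that depend
    on it alone are null or almost sure. *)
Lemma initial_event (y : conf) (A : set conf) (S : set (process_space X)) :
  measurable A -> measurable S ->
  Pr y (X 0 @^-1` A `&` S) = ((\1_A y)%:E * Pr y S)%E.
Proof.
move=> mA mS; have mXA := measurable_path_preimage (lexx 0) mA.
have mXnA := measurable_path_preimage (lexx 0) (measurableC mA).
rewrite indicE; have [yA|yA] := boolP (y \in A); last first.
  rewrite mul0e; apply: (@subset_measure0 _ _ _ (Pr y) _ (X 0 @^-1` A)) => //.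
    exact: measurableI.
  by have := sm_initial sm y mA; rewrite diracE (negbTE yA).
rewrite mul1e [RHS](measureDI _ mS mXA) setIC [X in (X + _)%E](_ : _ = 0%E) ?add0e//.
apply: (@subset_measure0 _ _ _ (Pr y) _ (X 0 @^-1` (~` A))) => //.
- exact: measurableD.
- by have := sm_initial sm y (measurableC mA); rewrite diracE in_setC yA.
Qed.

(** The case s = 0 of [strong_markov_extinction] says that two measures on
    configurations agree: the images under X_T of Pr x weighted by the indicator of
    extinction and by its conditional probability. Integrating phi against both
    gives the claim. *)
Lemma strong_markov_extinction_integral T G x (phi : conf -> \bar R) :
  stopping_time X T -> stopped_history (X := X) T G ->
  (forall y, (0 <= phi y)%E) -> measurable_fun setT phi ->
  let D : set (process_space X) := G `&` [set o | (T o < +oo)%E] in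
  (\int[Pr x]_(o in D) (phi (X (fine (T o)) o) * (\1_(extinction X) o)%:E) =
   \int[Pr x]_(o in D) (phi (X (fine (T o)) o) *
      (fine (Pr (X (fine (T o)) o) (extinction X)))%:E))%E.
Proof.
move=> sT hG phi0 mphi D.
have mD : measurable D.
  by apply: measurableI; [exact: hG.1|exact: (finite_time_measurable sm sT).1].
have [Z mZ ZE0] := stopped_position_extension sm sT hG (lexx 0).
have ZE (o : process_space X) : D o -> Z o = X (fine (T o)) o.
  by move=> Do; rewrite ZE0// addr0.
have m1 : measurable_fun setT (\1_(D `&` extinction X) : process_space X -> R).
  by apply: measurable_indic; exact: measurableI.
have p1 o : 0 <= (\1_(D `&` extinction X) o : R) by rewrite indicE.
pose g (o : process_space X) : R := \1_D o * fine (Pr (Z o) (extinction X)).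
have mg : measurable_fun setT g.
  apply: measurable_funM; first exact: measurable_indic.
  by apply: measurableT_comp => //; exact: (measurableT_comp (sm_kernel sm mE) mZ).
have g0 o : 0 <= g o by rewrite mulr_ge0 ?indicE// fine_ge0.
pose nu1 := image_measure (weighted_measure (Pr x) m1 p1) mZ.
pose nu2 := image_measure (weighted_measure (Pr x) mg g0) mZ.
have nuE A : measurable A -> nu1 A = nu2 A.
  move=> mA.
  pose H := [set o : process_space X | (T o < +oo)%E /\ A (X (fine (T o) + 0) o)].
  have mGHE : measurable (G `&` H `&` extinction X).
    apply: measurableI => //; apply: measurableI; first exact: hG.1.
    exact: (stopped_position sm (lexx 0) sT mA).1.
  transitivity (Pr x (G `&` H `&` extinction X)).
    transitivity (\int[Pr x]_o (\1_(G `&` H `&` extinction X) o)%:E)%E; last first.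
      by rewrite integral_indic ?setIT.
    rewrite /nu1 /= /pushforward /weighted_measure integral_mkcond.
    apply: eq_integral => o _; rewrite patchE !indicE.
    have [Do|Do] := pselect (D o); last first.
      have nDE : ~ (D `&` extinction X) o by case.
      rewrite (memNset nDE) if_same memNset// => -[[Go [To _]] _].
      by apply: Do; split.
    have [Ao|Ao] := pselect (A (Z o)); last first.
      rewrite memNset// memNset// => -[[_ [_ Ao']] _].
      by apply: Ao; rewrite ZE0.
    rewrite mem_set//; have [Eo|Eo] := pselect (extinction X o); last first.
      by rewrite memNset ?memNset// => -[].
    rewrite mem_set ?mem_set//; split => //; case: Do => Go To; split => //.
    by split => //; rewrite -ZE0.
  rewrite (strong_markov_extinction sT hG x (lexx 0) mA).
  rewrite /nu2 /= /pushforward /weighted_measure [LHS]integral_mkcond [RHS]integral_mkcond.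
  apply: eq_integral => o _; rewrite !patchE /g indicE.
  have [Do|Do] := boolP (o \in D); last by rewrite mul0r if_same.
  rewrite initial_event// mul1r indicE -ZE; last by rewrite inE in Do.
  rewrite (_ : (o \in Z @^-1` A) = (Z o \in A)); last by apply/idP/idP; rewrite !inE.
  case: ifPn => ZA; rewrite ?mul0e// mul1e fineK//.
  exact: fin_num_measure.
have mphiZ : measurable_fun setT (phi \o Z) by exact: measurableT_comp.
have phiZ0 o : (0 <= (phi \o Z) o)%E by exact: phi0.
have : (\int[nu1]_y phi y = \int[nu2]_y phi y)%E.
  by apply: eq_measure_integral => A mA _; exact: nuE.
rewrite /nu1 /nu2 !ge0_integral_pushforward// !preimage_setT !ge0_integral_weighted//.
have intD (q : process_space X -> R) :
    (\int[Pr x]_(o in D) (phi (X (fine (T o)) o) * (q o)%:E) =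
     \int[Pr x]_o ((phi \o Z) o * (\1_D o * q o)%:E))%E.
  rewrite integral_mkcond; apply: eq_integral => o _; rewrite patchE indicE.
  case: ifPn => Do; rewrite ?mul0r ?mule0// mul1r /= ZE//.
  by rewrite inE in Do.
rewrite !intD.
have <- : (\int[Pr x]_o ((phi \o Z) o * (\1_(D `&` extinction X) o)%:E) =
    \int[Pr x]_o ((phi \o Z) o * (\1_D o * \1_(extinction X) o)%:E))%E.
  by apply: eq_integral => o _; rewrite !indicE in_setI -natrM mulnb.
move=> ->; apply: eq_integral => o _; rewrite /g indicE.
have [Do|Do] := boolP (o \in D); last by rewrite !mul0r.
by rewrite inE in Do; rewrite -ZE.
Qed.

Lemma bounded_borelD (f g : 'I_ell -> euclidean R d -> R) :
  bounded_borel_nonneg f -> bounded_borel_nonneg g ->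
  bounded_borel_nonneg (fun i x => f i x + g i x).
Proof.
move=> bf bg i; have [mf f0 [C fC]] := bf i; have [mg g0 [C' gC]] := bg i; split.
- exact: measurable_funD.
- by move=> x; rewrite addr_ge0.
- by exists (C + C') => x; rewrite lerD.
Qed.

(** Conditioning on the past of t turns the indicator of extinction into
    exp(- <w, X_t>), which adds w to the test function f. *)
Lemma laplace_extinction (x : conf) f t : bounded_borel_nonneg f -> 0 <= t ->
  (\int[Pr x]_o ((expR (- pairing f (X t o)))%:E * (\1_(extinction X) o)%:E) =
   (expR (- pairing (V t (fun i y => f i y + w i 0)) x))%:E)%E.
Proof.
move=> bf t0.
pose phi (y : conf) : \bar R := (expR (- pairing f y))%:E.
have mphi : measurable_fun setT phi.
  apply/measurable_EFinP; apply: measurableT_comp => //; apply: measurable_funN.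
  exact: measurable_pairing.
have phi0 y : (0 <= phi y)%E by rewrite lee_fin expR_ge0.
have := strong_markov_extinction_integral x
  (stopping_time_cst X t0) (stopped_historyT (stopping_time_cst X t0)) phi0 mphi.
have -> : [set o : process_space X | (t%:E < +oo)%E] = setT.
  by apply/seteqP; split => // o _ /=; rewrite ltry.
rewrite setIT /= => ->.
rewrite -(sp_laplace sp x (bounded_borelD bf bw) t0) unlock.
apply: eq_integral => o _; rewrite extinction_probability -EFinM -expRD -opprD.
by rewrite pairingD.
Qed.

(** * The dual cumulant *)

Lemma solution_section (c : 'I_ell -> 'cV[R]_ell -> R) f v t i :
  cumulant_solution P c f v -> 0 <= t -> measurable_fun setT (v t i).
Proof.
move=> sol t0.
apply: (measurable_comp _ _ (cs_measurable sol i) (pair1_measurable t)).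
  exact: measurable_nonneg_times.
by move=> _ [y _ <-].
Qed.

(** For f = 0 both sides of [laplace_extinction] are extinction probabilities. *)
Lemma V_extinction_exponent t i x : 0 <= t -> V t wfun i x = w i 0.
Proof.
move=> t0.
have b0 : bounded_borel_nonneg (fun (_ : 'I_ell) (_ : euclidean R d) => 0 : R).
  exact: bounded_borel_cst.
have := laplace_extinction (point_mass i x) b0 t0.
rewrite (_ : (fun i0 y => 0 + w i0 0) = wfun); last first.
  by apply/funext => j; apply/funext => y; rewrite add0r.
rewrite (_ : (\int[_]_o _)%E = Pr (point_mass i x) (extinction X)); last first.
  transitivity (\int[Pr (point_mass i x)]_o (\1_(extinction X) o)%:E)%E.
    apply: eq_integral => o _; rewrite pairing_cst big1 ?oppr0 ?expR0 ?mul1e//.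
    by move=> j _; rewrite mul0r.
  by rewrite integral_indic ?setIT.
rewrite extinction_probability => -[/expR_inj/oppr_inj e].
have mV : measurable_fun setT (V t wfun i).
  exact: solution_section (sp_cumulant sp bw).1 t0.
rewrite -(pairing_point_mass x mV) -e pairing_point_mass//.
exact: measurable_cst.
Qed.

(** The cumulant is monotone in its data because the Laplace functional is. *)
Lemma V_ge_extinction_exponent f t i x : bounded_borel_nonneg f -> 0 <= t ->
  w i 0 <= V t (fun j y => f j y + w j 0) i x.
Proof.
move=> bf t0; have bfw := bounded_borelD bf bw.
rewrite -(V_extinction_exponent i x t0) -lerN2 -ler_expR -lee_fin.
have VE g : bounded_borel_nonneg g ->
    (expR (- V t g i x))%:E = 'E_(Pr (point_mass i x))[fun o => expR (- pairing g (X t o))]%E.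
  move=> bg; rewrite (sp_laplace sp)// pairing_point_mass//.
  exact: solution_section (sp_cumulant sp bg).1 t0.
have mexp g : bounded_borel_nonneg g ->
    measurable_fun setT (fun o : process_space X => (expR (- pairing g (X t o)))%:E).
  move=> bg; apply/measurable_EFinP; apply: measurableT_comp => //.
  apply: measurable_funN; apply: (measurableT_comp (measurable_pairing bg)).
  exact: measurable_cylinder.
rewrite !VE// unlock; apply: ge0_le_integral => //.
- exact: mexp.
- exact: mexp.
- move=> o _; rewrite lee_fin ler_expR lerN2 pairingD// lerDr.
  by apply: pairing_ge0 => j y; have [_ f0 _] := bf j.
Qed.

(** The constant w solves its own cumulant equation, so the integral term vanishes;
    at time 1 it equals psi(i, w). *)
Lemma mechanism_root i : psi i w = 0.
Proof.
have := cs_equation (sp_cumulant sp bw).1 i x0 (@ler01 R).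
rewrite V_extinction_exponent// (Rintegral_prob_cst (prob_kernel _)).
rewrite (@eq_Rintegral _ _ _ _ _ (fun=> psi i w)); last first.
  move=> s; rewrite inE/= in_itv/= => /andP[s0 s1].
  rewrite (@eq_Rintegral _ _ _ _ _ (fun=> psi i w)).
    by rewrite (Rintegral_prob_cst (prob_kernel _)).
  move=> y _; congr (mechanism _ _ _ _ _); apply/matrixP => j k.
  by rewrite mxE ord1 V_extinction_exponent// subr_ge0.
rewrite Rintegral_cst//= lebesgue_measure_itv/= lte01 oppr0 adde0 /= mulr1.
by lra.
Qed.

Lemma V_dag_ge0 f t i x : bounded_borel_nonneg f -> 0 <= t -> 0 <= dual_cumulant V w t f i x.
Proof. by move=> bf t0; rewrite subr_ge0; exact: V_ge_extinction_exponent. Qed.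

Lemma bounded_borel_prob_integrable (mu : {measure set (euclidean R d) -> \bar R})
    (g : euclidean R d -> R) : mu setT = 1%E -> measurable_fun setT g ->
  (forall y, 0 <= g y) -> (exists C, forall y, g y <= C) ->
  mu.-integrable setT (EFin \o g).
Proof.
move=> mu1 mg g0 [C gC]; apply: (bounded_integrable_prob mu1 (C := C)) => // y.
by rewrite ger0_norm.
Qed.

(** The kernels preserve constants, so v solves the dual equation for f if and only
    if v + w solves the original one for f + w. *)
Lemma dual_unique_cumulant_solution f : bounded_borel_nonneg f ->
  unique_cumulant_solution P (dual_mechanism psi w) f (fun t => dual_cumulant V w t f).
Proof.
move=> bf; have bfw := bounded_borelD bf bw.
have [sol uniq] := sp_cumulant sp bfw.
have split_f t i x : \int[P i t x]_y (f i y + wfun i y) = \int[P i t x]_y f i y + w i 0.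
  have [mf f0 fC] := bf i; have [mw w_ge0 wC] := bw i.
  rewrite RintegralD//; last 2 first.
  - by apply: bounded_borel_prob_integrable => //; exact: prob_kernel.
  - by apply: bounded_borel_prob_integrable => //; exact: prob_kernel.
  by rewrite (Rintegral_prob_cst (prob_kernel _)).
have shift_col i (u : 'I_ell -> R) :
    dual_mechanism psi w i (\col_j u j) = psi i (\col_j (u j + w j 0)).
  rewrite /dual_mechanism; congr (mechanism _ _ _ _ _).
  by apply/matrixP => j k; rewrite !mxE.
have shift (v : R -> 'I_ell -> euclidean R d -> R) :
    cumulant_solution P (dual_mechanism psi w) f v ->
    cumulant_solution P psi (fun i y => f i y + wfun i y) (fun t i x => v t i x + w i 0).
  move=> [v0 mv bv ev]; split.
  - by move=> t i x t0; rewrite addr_ge0// v0.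
  - by move=> i; apply: measurable_funD => //; exact: mv.
  - move=> T T0; have [C vC] := bv _ T0.
    exists (C + \sum_i w i 0) => t i x tT.
    apply: le_trans (ler_normD _ _) (lerD _ _); first exact: vC.
    by rewrite ger0_norm// (bigD1 i)//= lerDl sumr_ge0.
  - move=> t i x t0.
    have eqI : \int[lebesgue_measure]_(s in `[0, t])
        \int[P i s x]_y psi i (\col_j (v (t - s) j y + w j 0)) =
        \int[lebesgue_measure]_(s in `[0, t])
        \int[P i s x]_y dual_mechanism psi w i (\col_j v (t - s) j y).
      by apply: eq_Rintegral => s _; apply: eq_Rintegral => y _; rewrite shift_col.
    rewrite eqI [LHS](congr1 (fun r => r + w i 0) (ev t i x t0)).
    by rewrite addrAC -split_f.
split; last first.
  move=> v' sol' t i x t0; rewrite /dual_cumulant.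
  by apply/eqP; rewrite eq_sym subr_eq eq_sym; apply/eqP; exact: (uniq _ (shift _ sol')).
case: sol => v0 mv bv ev; split.
- by move=> t i x t0; exact: V_dag_ge0.
- by move=> i; apply: measurable_funB => //; exact: mv.
- move=> T T0; have [C vC] := bv _ T0.
  exists (C + \sum_i w i 0) => t i x tT.
  apply: le_trans (ler_normB _ _) (lerD _ _); first exact: vC.
  by rewrite ger0_norm// (bigD1 i)//= lerDl sumr_ge0.
- move=> t i x t0; rewrite /dual_cumulant (ev t i x t0) (split_f t i x) addrAC addrK.
  have -> : \int[lebesgue_measure]_(s in `[0, t]) \int[P i s x]_y dual_mechanism psi w i
      (\col_j (V (t - s) (fun j y => f j y + w j 0) j y - w j 0)) =
      \int[lebesgue_measure]_(s in `[0, t]) \int[P i s x]_y psi i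
      (\col_j V (t - s) (fun j y => f j y + wfun j y) j y).
    apply: eq_Rintegral => s _; apply: eq_Rintegral => y _.
    rewrite shift_col; congr (mechanism _ _ _ _ _).
    by apply/matrixP => j k; rewrite !mxE subrK.
  by [].
Qed.

(** * The conditioned process *)

(** The last argument is the value of the normalisation for a null event. *)
Definition extinct_process (x : conf) : probability (process_space X) R :=
  mnormalize (mrestr (Pr x) mE) (Pr x).

(** The harmonic function of the h-transform. *)
Let e (x : conf) : R := expR (- pairing wfun x).

Let e_gt0 x : 0 < e x. Proof. exact: expR_gt0. Qed.

Let PrE x : Pr x (extinction X) = (e x)%:E.
Proof. exact: extinction_probability. Qed.

Lemma extinct_processE x A :
  extinct_process x A = (Pr x (A `&` extinction X) * (e x)^-1%:E)%E.
Proof.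
apply: (@mnormalize_gt0 _ _ _ (mrestr (Pr x) mE)); first exact: e_gt0.
by rewrite /= /mrestr setTI; exact: PrE.
Qed.

Lemma extinct_process_integral x (F : process_space X -> \bar R) :
  (forall o, (0 <= F o)%E) -> measurable_fun setT F ->
  (\int[extinct_process x]_o F o =
   (e x)^-1%:E * \int[Pr x]_o (F o * (\1_(extinction X) o)%:E))%E.
Proof.
move=> F0 mF.
pose h (o : process_space X) : R := \1_(extinction X) o * (e x)^-1.
have m1 : measurable_fun setT (\1_(extinction X) : process_space X -> R).
  exact: measurable_indic.
have mh : measurable_fun setT h by apply: measurable_funM.
have h0 o : 0 <= h o by rewrite mulr_ge0 ?indicE// invr_ge0 ltW.
rewrite (eq_measure_integral (weighted_measure (Pr x) mh h0)); last first.
  move=> A mA _.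
  transitivity (Pr x (A `&` extinction X) * (e x)^-1%:E)%E; first exact: extinct_processE.
  transitivity (\int[Pr x]_(o in A) (h o)%:E)%E; last by [].
  rewrite integral_mkcond.
  transitivity (\int[Pr x]_o ((e x)^-1%:E * (\1_(A `&` extinction X) o)%:E))%E.
    rewrite ge0_integralZl//; last 2 first.
    - by apply/measurable_EFinP; apply: measurable_indic; exact: measurableI.
    - by rewrite lee_fin invr_ge0 ltW.
    have mAE : measurable (A `&` extinction X) by exact: measurableI.
    by rewrite integral_indic// setIT muleC.
  apply: eq_integral => o _; rewrite patchE /h !indicE in_setI -EFinM.
  by case: (o \in A); rewrite ?mulr0// mulrC.
rewrite ge0_integral_weighted// -ge0_integralZl//; last 3 first.
- by apply: emeasurable_funM => //; exact/measurable_EFinP.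
- by move=> o _; rewrite mule_ge0// lee_fin indicE.
- by rewrite lee_fin invr_ge0 ltW.
by apply: eq_integral => o _; rewrite /h EFinM muleA muleC.
Qed.

Lemma extinct_process_laplace x f t : bounded_borel_nonneg f -> 0 <= t ->
  'E_(extinct_process x)[fun o => expR (- pairing f (X t o))]%E =
  (expR (- pairing (dual_cumulant V w t f) x))%:E.
Proof.
move=> bf t0; have bfw := bounded_borelD bf bw.
rewrite unlock extinct_process_integral; last 2 first.
- by move=> o; rewrite lee_fin expR_ge0.
- apply/measurable_EFinP; apply: measurableT_comp => //; apply: measurable_funN.
  by apply: (measurableT_comp (measurable_pairing bf)); exact: measurable_cylinder.
rewrite (laplace_extinction x bf t0) -EFinM; congr EFin.
rewrite /e -expRN opprK -expRD; congr expR.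
have sol := (sp_cumulant sp bfw).1.
have -> : pairing (dual_cumulant V w t f) x =
    pairing (V t (fun i y => f i y + w i 0)) x - pairing wfun x.
  rewrite -sumrB; apply: eq_bigr => i _; rewrite -RintegralB//.
  - apply: bounded_borel_integrable; first exact: (solution_section _ sol t0).
    have [|C vC] := cs_locally_bounded sol (T := t + 1); first by rewrite ltr_wpDl.
    by exists C => y; apply: vC; rewrite t0 lerDl ler01.
  - apply: bounded_borel_integrable; first exact: measurable_cst.
    by exists `|w i 0| => y; exact: lexx.
by rewrite opprB.
Qed.

Let measurable_conditional A : measurable A ->
  measurable_fun setT (fun x => Pr x (A `&` extinction X) * (e x)^-1%:E)%E.
Proof.
move=> mA; apply: emeasurable_funM.
  by apply: (sm_kernel sm); exact: measurableI.
apply/measurable_EFinP.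
rewrite (_ : (fun x => (e x)^-1) = (fun x => expR (pairing wfun x))).
  by apply: measurableT_comp => //; exact: measurable_pairing.
by apply/funext => x; rewrite /e -expRN opprK.
Qed.

(** In the h-transform, the factor 1/e(X_T) of the kernel at X_T cancels the factor
    e(X_T) = Pr_{X_T} (extinction) that [strong_markov_extinction_integral] produces
    from the indicator of extinction; what remains is [strong_markov_extinction]. *)
Lemma extinct_process_strong_markov : strong_markov extinct_process.
Proof.
split.
- move=> x A mA.
  rewrite extinct_processE initial_event// PrE -muleA -EFinM divff ?gt_eqF//.
  by rewrite mulr1 diracE indicE.
- move=> A mA.
  rewrite (_ : extinct_process ^~ A =
      (fun x => Pr x (A `&` extinction X) * (e x)^-1%:E)%E).
    exact: measurable_conditional.
  by apply/funext => x; exact: extinct_processE.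
- exact: (sm_stopped sm).
move=> x T sT s s0 G hG A mA.
pose D : set (process_space X) := G `&` [set o | (T o < +oo)%E].
have mD : measurable D.
  by apply: measurableI; [exact: hG.1|exact: (finite_time_measurable sm sT).1].
rewrite extinct_processE (strong_markov_extinction sT hG x s0 mA) -/D.
have mXA := measurable_path_preimage s0 mA.
pose phi (y : conf) : \bar R := extinct_process y (X s @^-1` A).
have phiE y : phi y = (Pr y (X s @^-1` A `&` extinction X) * (e y)^-1%:E)%E.
  exact: extinct_processE.
have phi0 y : (0 <= phi y)%E by exact: measure_ge0.
have mphi : measurable_fun setT phi.
  rewrite (_ : phi = (fun y => Pr y (X s @^-1` A `&` extinction X) * (e y)^-1%:E)%E).
    exact: measurable_conditional.
  by apply/funext => y; exact: phiE.
have [Z mZ ZE] := stopped_position_extension sm sT hG (lexx 0).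
have -> : (\int[extinct_process x]_(o in D) extinct_process (X (fine (T o)) o) (X s @^-1` A) =
    \int[extinct_process x]_o (phi (Z o) * (\1_D o)%:E))%E.
  rewrite integral_mkcond; apply: eq_integral => o _; rewrite patchE indicE.
  case: ifPn => Do; rewrite ?mule0// mule1 ZE ?addr0//.
  by rewrite inE in Do.
rewrite extinct_process_integral; last 2 first.
- by move=> o; rewrite mule_ge0// lee_fin indicE.
- apply: emeasurable_funM; first exact: measurableT_comp.
  by apply/measurable_EFinP; exact: measurable_indic.
rewrite muleC; congr (_ * _)%E.
have -> : (\int[Pr x]_o (phi (Z o) * (\1_D o)%:E * (\1_(extinction X) o)%:E) =
   \int[Pr x]_(o in D) (phi (X (fine (T o)) o) * (\1_(extinction X) o)%:E))%E.
  rewrite [RHS]integral_mkcond; apply: eq_integral => o _; rewrite patchE !indicE.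
  case: ifPn => Do; rewrite ?mule0 ?mul0e// mule1 ZE ?addr0//.
  by rewrite inE in Do.
rewrite (strong_markov_extinction_integral x sT hG phi0 mphi).
apply: eq_integral => o _; rewrite phiE PrE -muleA -EFinM mulVf ?gt_eqF//.
by rewrite mule1.
Qed.

End extinction_theory.

(** * The superprocess conditioned on extinction *)

Theorem proposition3 (R : realType) (d ell : nat)
    (P : 'I_ell -> R -> R.-pker (euclidean R d) ~> (euclidean R d))
    (B : 'M[R]_ell) (beta : 'I_ell -> R)
    (Pi : 'I_ell -> {measure set (euclidean R ell) -> \bar R})
    (V : R -> ('I_ell -> euclidean R d -> R) -> 'I_ell -> euclidean R d -> R)
    (Omega : pointedType) (X : R -> Omega -> configurations R d ell)
    (Pr : configurations R d ell -> probability (process_space X) R)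
    (x0 : euclidean R d) :
  branching_parameters B beta Pi ->
  irreducible_matrix (Btilde B Pi)^T ->
  superprocess P (mechanism B beta Pi) V Pr ->
  measurable (extinction X) ->
  (forall i, (0 < extinction_exponent Pr x0 i < +oo)%E) ->
  let w : 'cV[R]_ell := \col_i fine (extinction_exponent Pr x0 i) in
  let psi_dag := dual_mechanism (mechanism B beta Pi) w in
  let V_dag := dual_cumulant V w in
  exists Pr_dag : configurations R d ell -> probability (process_space X) R,
    [/\ forall mu A, measurable A ->
          Pr_dag mu A = (Pr mu (A `&` extinction X) / Pr mu (extinction X))%E,
        forall mu f t, bounded_borel_nonneg f -> 0 <= t ->
          'E_(Pr_dag mu)[fun o => expR (- pairing f (X t o))]%E =
          (expR (- pairing (V_dag t f) mu))%:E,
        forall f, bounded_borel_nonneg f ->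
          unique_cumulant_solution P psi_dag f (fun t => V_dag t f) &
        superprocess P psi_dag V_dag Pr_dag].
Proof.
move=> bp _ sp mE w_fin w psi_dag V_dag.
have dual_laplace := extinct_process_laplace bp sp mE w_fin.
have dual_unique := dual_unique_cumulant_solution bp sp mE w_fin.
exists (extinct_process Pr mE); split=> //.
- move=> mu A _.
  rewrite (extinct_processE bp sp mE w_fin) (extinction_probability bp sp mE w_fin).
  by rewrite inver gt_eqF ?expR_gt0.
- split=> //.
  + exact: sp_diffusion sp.
  + apply: (dual_branching_mechanism bp).
      exact: extinction_exponent_orthant w_fin.
    exact: mechanism_root bp sp mE w_fin.
  + exact: sp_paths sp.
  + exact: extinct_process_strong_markov bp sp mE w_fin.
Qed.
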